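(* Let $p\in\mathbb{R}$ and $s\in[0,1]$. (1) If $p\le\frac12$ and $0\le s\le\frac12$, then $|||B_p(S,T)X|||\le|||H_s(S,T)X|||$. (2) If $p\ge\frac12$ and $\frac12\le s\le1$, then $|||B_p(S,T)X|||\ge|||H_s(S,T)X|||$. Here each inequality is asserted for all $n\in\mathbb{N}$, all unitarily invariant norms $|||\cdot|||$ on $M_n(\mathbb{C})$, all positive semi-definite $S,T\in M_n(\mathbb{C})$ and all $X\in M_n(\mathbb{C})$.
   Context: $M_n(\mathbb{C})$ is the set of $n\times n$ complex matrices. A norm $|||\cdot|||$ on $M_n(\mathbb{C})$ is unitarily invariant if $|||UXV|||=|||X|||$ for all unitary $U,V$ and all $X$. For $a,b>0$ the binomial (power) mean is $B_p(a,b)=\left(\frac{a^p+b^p}{2}\right)^{1/p}$ for $p\ne0$ and $B_0(a,b)=\sqrt{ab}$; the Heron mean is $H_s(a,b)=s\sqrt{ab}+(1-s)\frac{a+b}{2}$ for $0\le s\le1$. Means are extended from $(0,\infty)^2$ to $[0,\infty)^2$ by continuity. For a symmetric homogeneous mean $M(a,b)$ and positive semi-definite $S,T\in M_n(\mathbb{C})$ with $S=U\,\mathrm{diag}(\lambda_1,\dots,\lambda_n)U^*$, $T=V\,\mathrm{diag}(\mu_1,\dots,\mu_n)V^*$ ($U,V$ unitary), and $X\in M_n(\mathbb{C})$, define $M(S,T)X:=U\left([M(\lambda_i,\mu_j)]_{i,j=1,\dots,n}\circ(U^*XV)\right)V^*$, where $\circ$ is the Hadamard (entrywise) product. *)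

(* Defs.v *)
From HB Require Import structures.
From mathcomp Require Import all_boot all_order all_algebra.
From mathcomp Require Export complex.
From mathcomp Require Import all_classical all_reals all_analysis.

Set Implicit Arguments.
Unset Strict Implicit.
Unset Printing Implicit Defensive.

Import Order.TTheory GRing.Theory Num.Theory.
Import numFieldNormedType.Exports.
Local Open Scope classical_set_scope.
Local Open Scope ring_scope.
Local Open Scope sesquilinear_scope.
Local Open Scope complex_scope.

Section Means.
Variable R : realType.
Implicit Types (M : R -> R -> R) (p s a b : R).

(* Only the values at positive arguments are meaningful; for p < 0 the formula
   below does not give the continuous extension at the boundary, because of the
   library convention 0 `^ p = 0. *)
Definition binomial_mean p a b : R :=
  if p == 0 then Num.sqrt (a * b) else ((a `^ p + b `^ p) / 2) `^ p^-1.

Definition heron_mean s a b : R :=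
  s * Num.sqrt (a * b) + (1 - s) * ((a + b) / 2).

Definition pos_quadrant : set (R * R) := [set z | 0 < z.1 /\ 0 < z.2].

(* Extension by continuity from the open to the closed positive quadrant. *)
Definition mean_ext M a b : R :=
  lim (M z.1 z.2 @[z --> within pos_quadrant (nbhs (a, b))]).

Let F a b := within pos_quadrant (nbhs (a, b)).

Lemma pos_quadrant_proper a b : 0 <= a -> 0 <= b ->
  ProperFilter (within pos_quadrant (nbhs (a, b))).
Proof.
move=> a0 b0; apply: within_nbhs_proper => A [[P Q] /= [/nbhs_ballP[e e0 eP]
  /nbhs_ballP[d d0 dQ]] PQA].
have e20 : 0 < e / 2 by rewrite divr_gt0.
have d20 : 0 < d / 2 by rewrite divr_gt0.
exists (a + e / 2, b + d / 2); split => /=; first by split; rewrite ltr_wpDl.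
apply: PQA; split => /=.
  by apply: eP; rewrite /ball /= opprD addNKr normrN gtr0_norm// ltr_pdivrMr// ltr_pMr// ltr1n.
by apply: dQ; rewrite /ball /= opprD addNKr normrN gtr0_norm// ltr_pdivrMr// ltr_pMr// ltr1n.
Qed.

Lemma mean_extE M a b l : 0 <= a -> 0 <= b ->
  M z.1 z.2 @[z --> within pos_quadrant (nbhs (a, b))] --> l ->
  mean_ext M a b = l.
Proof.
by move=> a0 b0; have := pos_quadrant_proper a0 b0 => ?; exact: cvg_lim.
Qed.

Lemma cvg_powR {T : Type} (G : set_system T) {FG : Filter G} (f : T -> R) p a :
  (\forall z \near G, 0 < f z) -> 0 < a \/ (0 < p /\ 0 <= a) ->
  f z @[z --> G] --> a -> f z `^ p @[z --> G] --> a `^ p.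
Proof.
have pos : 0 < a -> f z @[z --> G] --> a -> f z `^ p @[z --> G] --> a `^ p.
  move=> a0 fa; apply: (@continuous_cvg _ _ _ _ _ f (@powR R ^~ p)) => //.
  apply/differentiable_continuous; rewrite -derivable1_diffP.
  by apply: derivable_powR; rewrite in_itv/= a0.
move=> fpos [a0|[p0 a0]] fa; first exact: pos.
move: a0; rewrite le_eqVlt => /predU1P[a0|a0]; last exact: pos.
rewrite -a0 powR0 ?gt_eqF//.
have f0 : f z @[z --> G] --> (0 : R)^'+.
  move=> A [e e0 eA]; rewrite /= /nbhs /=.
  move: fa; rewrite -a0 => /cvgrPdist_lt/(_ e e0) fe.
  near=> z; apply: eA => /=.
    by near: z.
  by near: z.
exact: (@cvg_comp _ _ _ f (@powR R ^~ p) _ _ _ f0 (powR_cvg0 p0)).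
Unshelve. all: by end_near. Qed.

Let fst_cvg a b : z.1 @[z --> F a b] --> a.
Proof. by apply: cvg_trans (@cvg_fst _ _ (nbhs a) (nbhs b) _); apply: cvg_app; exact: cvg_within. Qed.

Let snd_cvg a b : z.2 @[z --> F a b] --> b.
Proof. by apply: cvg_trans (@cvg_snd _ _ (nbhs a) (nbhs b) _); apply: cvg_app; exact: cvg_within. Qed.

Let Fpos a b : \forall z \near F a b, 0 < z.1 /\ 0 < z.2.
Proof. by rewrite /F; near=> z; near: z; exact: withinT. Unshelve. all: by end_near. Qed.

Let sqrt_mul_cvg a b : Num.sqrt (z.1 * z.2) @[z --> F a b] --> Num.sqrt (a * b).
Proof.
apply: (@continuous_cvg _ _ _ (F a b) _ (fun z => z.1 * z.2) (@Num.sqrt R)).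
  exact: sqrt_continuous.
by apply: cvgM; [exact: fst_cvg|exact: snd_cvg].
Qed.

Lemma heron_mean_cvg s a b :
  heron_mean s z.1 z.2 @[z --> within pos_quadrant (nbhs (a, b))] -->
  heron_mean s a b.
Proof.
apply: cvgD; first by apply: cvgM; [exact: cvg_cst|exact: sqrt_mul_cvg].
apply: cvgM; first exact: cvg_cst.
by apply: cvgM; [apply: cvgD; [exact: fst_cvg|exact: snd_cvg]|exact: cvg_cst].
Qed.

Lemma heron_mean_ext s a b : 0 <= a -> 0 <= b ->
  mean_ext (heron_mean s) a b = heron_mean s a b.
Proof. by move=> a0 b0; apply: mean_extE => //; exact: heron_mean_cvg. Qed.

Lemma binomial_mean_le p a b : p < 0 -> 0 < a -> 0 < b ->
  binomial_mean p a b <= 2^-1 `^ p^-1 * a.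
Proof.
move=> p0 a0 b0; rewrite /binomial_mean lt_eqF//.
have ap : 0 < a `^ p by exact: powR_gt0.
have bp : 0 < b `^ p by exact: powR_gt0.
have -> : 2^-1 `^ p^-1 * a = (a `^ p / 2) `^ p^-1.
  by rewrite mulrC powRM ?powR_ge0 ?invr_ge0// -powRrM mulfV ?lt_eqF// powRr1 ?ltW.
rewrite -[p^-1]opprK powRN (powRN (a `^ p / 2)) lef_pV2 ?posrE; last 2 first.
- by rewrite powR_gt0// divr_gt0// addr_gt0.
- by rewrite powR_gt0// divr_gt0.
rewrite ge0_ler_powR ?nnegrE ?oppr_ge0 ?invr_le0 ?divr_ge0 ?addr_ge0 ?ltW//.
by rewrite ltr_pM2r ?invr_gt0// ltrDl.
Qed.

Lemma binomial_meanC p a b : binomial_mean p a b = binomial_mean p b a.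
Proof. by rewrite /binomial_mean mulrC addrC. Qed.

Lemma binomial_mean_cvg p a b : 0 <= a -> 0 <= b ->
  binomial_mean p z.1 z.2 @[z --> within pos_quadrant (nbhs (a, b))] -->
  (if (p < 0) && ((a == 0) || (b == 0)) then 0 else binomial_mean p a b).
Proof.
move=> a0 b0; have [p0|p0|->] := ltgtP p 0 => /=; last 2 first.
- rewrite /binomial_mean gt_eqF//.
  apply: cvg_powR.
  + near=> z; have [z1 z2] : 0 < z.1 /\ 0 < z.2 by near: z; exact: Fpos.
    by rewrite divr_gt0// addr_gt0// powR_gt0.
  + by right; rewrite invr_gt0 p0 divr_ge0// addr_ge0// powR_ge0.
  + apply: cvgM; last exact: cvg_cst.
    apply: cvgD; apply: cvg_powR => //; try by [right|exact: fst_cvg|exact: snd_cvg].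
      by near=> z; have [] : 0 < z.1 /\ 0 < z.2 by near: z; exact: Fpos.
    by near=> z; have [] : 0 < z.1 /\ 0 < z.2 by near: z; exact: Fpos.
- by rewrite /binomial_mean eqxx; exact: sqrt_mul_cvg.
case: ifPn => [ab0|]; last first.
  rewrite negb_or => /andP[an bn].
  have {an}a_gt0 : 0 < a by rewrite lt_neqAle eq_sym an.
  have {bn}b_gt0 : 0 < b by rewrite lt_neqAle eq_sym bn.
  rewrite /binomial_mean lt_eqF//.
  apply: cvg_powR.
  + near=> z; have [z1 z2] : 0 < z.1 /\ 0 < z.2 by near: z; exact: Fpos.
    by rewrite divr_gt0// addr_gt0// powR_gt0.
  + by left; rewrite divr_gt0// addr_gt0// powR_gt0.
  + apply: cvgM; last exact: cvg_cst.
    apply: cvgD; apply: cvg_powR => //; try by [left|exact: fst_cvg|exact: snd_cvg].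
      by near=> z; have [] : 0 < z.1 /\ 0 < z.2 by near: z; exact: Fpos.
    by near=> z; have [] : 0 < z.1 /\ 0 < z.2 by near: z; exact: Fpos.
have bge z : 0 <= binomial_mean p z.1 z.2 by rewrite /binomial_mean lt_eqF// powR_ge0.
case/orP: ab0 => /eqP ab0.
  apply: (@squeeze_cvgr _ _ _ _ (fun=> 0) (fun z => 2^-1 `^ p^-1 * z.1)).
  - near=> z; rewrite bge /=.
    have [z1 z2] : 0 < z.1 /\ 0 < z.2 by near: z; exact: Fpos.
    exact: binomial_mean_le.
  - exact: cvg_cst.
  - rewrite -[X in _ --> X](mulr0 (2^-1 `^ p^-1)) -[X in _ * X]ab0.
    by apply: cvgM; [exact: cvg_cst|exact: fst_cvg].
apply: (@squeeze_cvgr _ _ _ _ (fun=> 0) (fun z => 2^-1 `^ p^-1 * z.2)).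
- near=> z; rewrite bge /=.
  have [z1 z2] : 0 < z.1 /\ 0 < z.2 by near: z; exact: Fpos.
  by rewrite binomial_meanC; exact: binomial_mean_le.
- exact: cvg_cst.
- rewrite -[X in _ --> X](mulr0 (2^-1 `^ p^-1)) -[X in _ * X]ab0.
  by apply: cvgM; [exact: cvg_cst|exact: snd_cvg].
Unshelve. all: by end_near. Qed.

Lemma binomial_mean_ext p a b : 0 <= a -> 0 <= b ->
  mean_ext (binomial_mean p) a b =
  if (p < 0) && ((a == 0) || (b == 0)) then 0 else binomial_mean p a b.
Proof. by move=> a0 b0; apply: mean_extE => //; exact: binomial_mean_cvg. Qed.

End Means.

Section Matrices.
Variables (R : realType) (n : nat).
Local Notation C := R[i].
Implicit Types (M : R -> R -> R) (S T U V X Y : 'M[C]_n) (lam mu : 'rV[R]_n).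

Definition possemidefmx S : Prop :=
  S \is hermsymmx /\ forall v : 'cV[C]_n, 0 <= (v^t* *m S *m v) 0 0.

Record unitarily_invariant_norm (N : 'M[C]_n -> R) : Prop := {
  uin_ge0 : forall X, 0 <= N X ;
  uin_eq0 : forall X, N X = 0 -> X = 0 ;
  uin_scale : forall (c : C) X, N (c *: X) = ComplexField.Normc.normc c * N X ;
  uin_triangle : forall X Y, N (X + Y) <= N X + N Y ;
  uin_unitary : forall U V X,
    U \is unitarymx -> V \is unitarymx -> N (U *m X *m V) = N X }.

Definition diagC lam : 'M[C]_n := diag_mx (map_mx (real_complex R) lam).

(* M is given on positive arguments and extended here to eigenvalues that may be
   zero; map2_mx *%R is the Hadamard product. *)
Definition mean_op_eig M U lam V mu X : 'M[C]_n :=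
  U *m map2_mx *%R (\matrix_(i, j) (mean_ext M (lam 0 i) (mu 0 j))%:C)
                   (U^t* *m X *m V) *m V^t*.

(* M(S,T)X, computed with the library's spectral decompositions
   S = P^t* *m diag_mx (spectral_diag S) *m P, where P = spectralmx S. By
   mean_op_spectral below, any other unitary diagonalizations of S and T give
   the same matrix. The diagonals are real when S and T are Hermitian. *)
Definition mean_op M S T X : 'M[C]_n :=
  mean_op_eig M ((spectralmx S)^t*) (map_mx (@complex.Re R) (spectral_diag S))
                ((spectralmx T)^t*) (map_mx (@complex.Re R) (spectral_diag T)) X.

Lemma hermsymmx_spectral S : S \is hermsymmx ->
  S = (spectralmx S)^t* *m diagC (map_mx (@complex.Re R) (spectral_diag S))
      *m ((spectralmx S)^t*)^t*.
Proof.
move=> Sh; have /orthomx_spectralP := hermitian_normalmx Sh.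
rewrite invmx_unitary ?spectral_unitarymx// trmxCK => {1}->.
congr (_ *m _ *m _); rewrite /diagC; congr diag_mx.
apply/rowP => i; rewrite !mxE; apply/esym/RRe_real.
by have /mxOverP := hermitian_spectral_diag_real Sh.
Qed.

Lemma possemidefmx_spectral_ge0 S i : possemidefmx S ->
  0 <= complex.Re (spectral_diag S 0 i).
Proof.
move=> [Sh S0]; set P := spectralmx S.
have PU : P \is unitarymx by exact: spectral_unitarymx.
have := S0 (P^t* *m delta_mx i 0).
rewrite {1}(hermsymmx_spectral Sh) -/P.
rewrite trmx_mul map_mxM !trmxCK !mulmxA.
have /unitarymxP PP := PU.
rewrite -!mulmxA (mulmxA P) PP mul1mx !mulmxA.
rewrite -(mulmxA _ P) PP mulmx1.
rewrite trmx_delta map_delta_mx -rowE -colE /diagC.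
by rewrite !mxE eqxx mulr1n ler0c.
Qed.

Lemma mean_op_eig_uniq M U lam V mu U' lam' V' mu' X :
    U \is unitarymx -> V \is unitarymx ->
    U' \is unitarymx -> V' \is unitarymx ->
    U *m diagC lam *m U^t* = U' *m diagC lam' *m U'^t* ->
    V *m diagC mu *m V^t* = V' *m diagC mu' *m V'^t* ->
  mean_op_eig M U lam V mu X = mean_op_eig M U' lam' V' mu' X.
Proof.
have step (W W' : 'M[C]_n) (l l' : 'rV[R]_n) : W \is unitarymx -> W' \is unitarymx ->
    W *m diagC l *m W^t* = W' *m diagC l' *m W'^t* ->
    forall i j, (W'^t* *m W) i j != 0 -> l 0 j = l' 0 i.
  move=> hW hW' e i j.
  have W1 : W^t* *m W = 1%:M.
    by have /unitarymxP h := hW; exact: (mulmx1C h).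
  have W1' : W'^t* *m W' = 1%:M.
    by have /unitarymxP h := hW'; exact: (mulmx1C h).
  have : W'^t* *m (W *m diagC l *m W^t*) *m W =
         W'^t* *m (W' *m diagC l' *m W'^t*) *m W by rewrite e.
  rewrite !mulmxA W1' mul1mx -(mulmxA _ (W^t*)) W1 mulmx1 -(mulmxA (diagC l')).
  move: (W'^t* *m W) => Z h nz; move/matrixP/(_ i j): h.
  by rewrite /diagC mul_mx_diag mul_diag_mx !mxE mulrC => /(mulIf nz)/complexI.
move=> hU hV hU' hV' eU eV.
have sU := step _ _ _ _ hU hU' eU.
have sV := step _ _ _ _ hV hV' eV.
rewrite /mean_op_eig.
have U1 := unitarymxP hU; have V1 := unitarymxP hV.
have V1' := mulmx1C (unitarymxP hV'); have U1' := mulmx1C (unitarymxP hU').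
have V1t := mulmx1C V1.
set A := \matrix_(i, j) _; set A' := \matrix_(i, j) _.
set P := U'^t* *m U in sU *; set Q := V'^t* *m V in sV *.
set Y := U^t* *m X *m V.
have -> : U'^t* *m X *m V' = P *m Y *m Q^t*.
  rewrite /P /Y /Q trmx_mul map_mxM trmxCK !mulmxA.
  rewrite -(mulmxA _ U) U1 mulmx1 -(mulmxA _ V) V1 mulmx1//.
have AA i j k l : P i k != 0 -> Q j l != 0 -> A k l = A' i j.
  by move=> /sU e /sV e'; rewrite !mxE e e'.
have eq2 : map2_mx *%R A' (P *m Y *m Q^t*) = P *m map2_mx *%R A Y *m Q^t*.
  move: P Q A A' Y AA {sU sV} => P Q A A' Y AA.
  apply/matrixP => i j; rewrite !mxE mulr_sumr; apply: eq_bigr => k _.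
  rewrite !mxE mulrA mulr_sumr !mulr_suml; apply: eq_bigr => l _.
  rewrite !mxE.
  have [->|Pn] := eqVneq (P i l) 0; first by rewrite !(mul0r, mulr0).
  have [->|Qn] := eqVneq (Q j k) 0; first by rewrite conjC0 !mulr0.
  by rewrite (AA _ _ _ _ Pn Qn) !mulrA (mulrC (A' i j)).
rewrite eq2 /P /Q trmx_mul map_mxM trmxCK !mulmxA.
by rewrite (unitarymxP hU') mul1mx -[RHS]mulmxA (unitarymxP hV') mulmx1.
Qed.

Lemma mean_op_spectral M S T U lam V mu X :
    U \is unitarymx -> V \is unitarymx ->
    S = U *m diagC lam *m U^t* -> T = V *m diagC mu *m V^t* ->
  mean_op M S T X = mean_op_eig M U lam V mu X.
Proof.
have herm W (l : 'rV[R]_n) : W *m diagC l *m W^t* \is hermsymmx.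
  apply/is_hermitianmxP; rewrite expr0 scale1r !trmx_mul !map_mxM trmxCK mulmxA.
  congr (_ *m _ *m _); rewrite /diagC tr_diag_mx map_diag_mx; congr diag_mx.
  by apply/rowP => i; rewrite !mxE; apply/esym/CrealP/complex_realP; exists (l 0 i).
move=> hU hV eS eT; apply: mean_op_eig_uniq => //.
- by rewrite trmxC_unitary spectral_unitarymx.
- by rewrite trmxC_unitary spectral_unitarymx.
- by rewrite -hermsymmx_spectral ?eS ?herm.
- by rewrite -hermsymmx_spectral ?eT ?herm.
Qed.

End Matrices.

(* Main.v *)
From HB Require Import structures.
Require Import Defs.
From mathcomp Require Import all_boot all_order all_algebra.
From mathcomp Require Import all_classical all_reals all_analysis.
From mathcomp Require Import ring lra zify.
Import Order.TTheory GRing.Theory Num.Theory.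
Import numFieldNormedType.Exports.
Set Implicit Arguments.
Unset Strict Implicit.
Unset Printing Implicit Defensive.
Local Open Scope classical_set_scope.
Local Open Scope ring_scope.

(** Both means have the form sqrt(ab) * k(ln a - ln b): for the Heron mean
    k(t) = s + (1 - s) cosh(t/2), for the binomial mean
    k(t) = cosh(pt/2)^(1/p) (and 1 if p = 0). If k1 = f k2 with f(0) = 1, the
    matrix of the first mean is the entrywise product of the matrix of the
    second one with [f(x_i - y_j)], where x_i and y_j are the logarithms of the
    eigenvalues. So it suffices to show that Schur multiplication by
    [f(x_i - y_j)] never increases a unitarily invariant norm; zero eigenvalues
    are reached by continuity ([mean_op_le]).

    A function f with that property (with the constant f(0), which need not
    be 1) is called [contractive]. If f(t) = cos t, the multiplier is the average
    of two maps X |-> D X E with D, E diagonal unitaries, hence cos is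
    contractive ([contractive_cos]). Contractivity is preserved by sums,
    products, nonnegative multiples, dilations of the variable and pointwise
    limits. If exp(-t psi) is contractive for every t >= 0, psi is called a
    [levy_exponent]; those functions form a convex cone, closed under pointwise
    limits, which contains every 1 - cos(w u).

    The mean with p = 1/2 is the Heron mean with s = 1/2, and corresponds to
    k(t) = cosh(t/4)^2. Comparing both sides of the inequality with it, the
    Heron side only involves g(t) = cosh(t/4)^(-2), through 1/(1 - c g) with
    0 <= c < 1 (a power series in g with nonnegative coefficients) or through
    an affine function of g with nonnegative coefficients. The binomial side and
    g itself need that ln cosh(u), and ln cosh(ru) - r ln cosh(u) for r >= 1,
    are Levy exponents ([lncosh_levy], [lncosh_diff_levy]).

    The reason is the Levy-Khinchine formula
      ln cosh u = int_0^oo (1 - cos(ux)) / (x sinh(pi x / 2)) dx,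
    which gives ln cosh(ru) - r ln cosh(u) the density
    (1/sinh(pi x / 2r) - r/sinh(pi x / 2)) / x, nonnegative because
    sinh(ra) >= r sinh(a). The proof uses a discrete form of the formula: the
    sums over the grid x = d, 2d, 3d, ... converge to ln cosh u as d tends to 0
    ([csch_lim_cvg]), and they are manifestly combinations of functions
    1 - cos(w u). To identify the limit, expand 1/sinh in a geometric series and
    sum over the grid first: each term becomes the logarithm of
    1 + (sin(du/2) / sinh(dz/2))^2 with z = (2k+1) pi/2 ([poisson_log_expR]),
    which is at most ln(1 + (u/z)^2) and tends to it. Summing over k and
    invoking Euler's product cosh u = prod_k (1 + (u/z_k)^2), in the quantitative
    form [prod_le_cosh] and [cosh_le_prod], gives ln cosh u. *)

(** * Hyperbolic and trigonometric inequalities *)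

(** Locked, so that rewriting with lemmas on products and quotients does not act
    inside cosh and sinh. *)
HB.lock Definition cosh (R : realType) (x : R) : R := (expR x + expR (- x)) / 2.
HB.lock Definition sinh (R : realType) (x : R) : R := (expR x - expR (- x)) / 2.

Section Hyperbolic.
Variable R : realType.
Implicit Types (x y u v t : R).

Lemma ge0_derive_le (f df : R -> R) b : 0 <= b ->
  (forall x, is_derive x 1 f (df x)) -> (forall x, 0 <= x <= b -> 0 <= df x) ->
  f 0 <= f b.
Proof.
move=> b0 fd df0.
have cf : {within `[0, b], continuous f}.
  apply: continuous_subspaceT => x; apply/differentiable_continuous.
  by apply/derivable1_diffP; exact: ex_derive.
have [c] := MVT_segment b0 (fun x _ => fd x) cf.
rewrite in_itv /= => cb /eqP; rewrite subr0 subr_eq => /eqP ->.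
by rewrite lerDr mulr_ge0// df0.
Qed.

Lemma coshE x : cosh x = (expR x + expR (- x)) / 2.
Proof. by rewrite cosh.unlock. Qed.

Lemma sinhE x : sinh x = (expR x - expR (- x)) / 2.
Proof. by rewrite sinh.unlock. Qed.

Global Instance is_derive_cosh x : is_derive x 1 (@cosh R) (sinh x).
Proof.
rewrite (_ : @cosh R = fun y => (expR y + expR (- y)) / 2); last first.
  by apply/funext => y; rewrite coshE.
by apply: is_derive_eq; rewrite sinhE /GRing.scale /=; lra.
Qed.

Global Instance is_derive_sinh x : is_derive x 1 (@sinh R) (cosh x).
Proof.
rewrite (_ : @sinh R = fun y => (expR y - expR (- y)) / 2); last first.
  by apply/funext => y; rewrite sinhE.
by apply: is_derive_eq; rewrite coshE /GRing.scale /=; lra.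
Qed.

Lemma cosh0 : cosh (0 : R) = 1.
Proof. by rewrite coshE oppr0 expR0; field. Qed.

Lemma sinh0 : sinh (0 : R) = 0.
Proof. by rewrite sinhE oppr0 subrr mul0r. Qed.

Lemma coshN x : cosh (- x) = cosh x.
Proof. by rewrite !coshE opprK addrC. Qed.

Lemma sinhN x : sinh (- x) = - sinh x.
Proof. by rewrite !sinhE opprK -mulNr opprB. Qed.

Lemma coshD x y : cosh (x + y) = cosh x * cosh y + sinh x * sinh y.
Proof. by rewrite !(coshE, sinhE) opprD !expRD; field. Qed.

Lemma cosh2Bsinh2 x : cosh x ^+ 2 - sinh x ^+ 2 = 1.
Proof.
have e : expR x * expR (- x) = 1 by rewrite expRxMexpNx_1.
by rewrite !(coshE, sinhE) -[RHS]e; field.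
Qed.

Lemma cosh_double x : cosh (2 * x) = 1 + 2 * sinh x ^+ 2.
Proof.
have := cosh2Bsinh2 x; rewrite (_ : 2 * x = x + x) ?coshD; last by ring.
by move=> h; rewrite -[X in _ = X + _]h; ring.
Qed.

Lemma cosh_gt0 x : 0 < cosh x.
Proof. by rewrite coshE divr_gt0// addr_gt0// expR_gt0. Qed.

Lemma cosh_ge1 x : 1 <= cosh x.
Proof.
have c0 := ltW (cosh_gt0 x).
suff : 1 ^+ 2 <= cosh x ^+ 2 by rewrite ler_pXn2r ?nnegrE ?ler01.
rewrite expr1n.
by have := cosh2Bsinh2 x; have := sqr_ge0 (sinh x); lra.
Qed.

Lemma continuous_cosh : continuous (@cosh R).
Proof.
move=> x; apply/differentiable_continuous/derivable1_diffP; exact: ex_derive.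
Qed.

Lemma sinh_ge x : 0 <= x -> x <= sinh x.
Proof.
move=> x0; rewrite -subr_ge0.
have := @ge0_derive_le (fun x => sinh x - x) (fun x => cosh x - 1) x x0.
by rewrite sinh0 subr0; apply=> y; rewrite subr_ge0 cosh_ge1.
Qed.

Lemma sinh_ge0 x : 0 <= x -> 0 <= sinh x.
Proof. by move=> x0; rewrite (le_trans x0)// sinh_ge. Qed.

Lemma sinh_gt0 x : 0 < x -> 0 < sinh x.
Proof. by move=> x0; rewrite (lt_le_trans x0)// sinh_ge// ltW. Qed.

Lemma sinh_le x : 0 <= x -> sinh x <= x * cosh x.
Proof.
move=> x0; rewrite -subr_ge0.
have := @ge0_derive_le (fun x => x * cosh x - sinh x) (fun x => x * sinh x) x x0.
rewrite sinh0 mul0r subr0; apply=> y; last by case/andP=> ? _; rewrite mulr_ge0 ?sinh_ge0.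
by apply: is_derive_eq; rewrite /GRing.scale /=; ring.
Qed.

Lemma cosh_homo x y : 0 <= x -> x <= y -> cosh x <= cosh y.
Proof.
move=> x0 xy; rewrite -subr_ge0 -[y](subrK x).
have yx : 0 <= y - x by rewrite subr_ge0.
have := @ge0_derive_le (fun z => cosh (z + x)) (fun z => sinh (z + x)) _ yx.
rewrite subr_ge0 add0r; apply=> z.
  by apply: is_derive_eq; rewrite /GRing.scale /=; ring.
by case/andP=> ? _; rewrite sinh_ge0// addr_ge0.
Qed.

Lemma sinh_mul_ge r x : 1 <= r -> 0 <= x -> r * sinh x <= sinh (r * x).
Proof.
move=> r1 x0; rewrite -subr_ge0.
have := @ge0_derive_le (fun x => sinh (r * x) - r * sinh x)
  (fun x => r * (cosh (r * x) - cosh x)) x x0.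
rewrite mulr0 sinh0 mulr0 subr0; apply=> y.
  by apply: is_derive_eq; rewrite /GRing.scale /=; ring.
case/andP=> y0 _; rewrite mulr_ge0//; first by rewrite (le_trans _ r1).
by rewrite subr_ge0 cosh_homo// ler_peMl.
Qed.

Lemma sin_le_id x : 0 <= x -> sin x <= x.
Proof.
move=> x0; rewrite -subr_ge0.
have := @ge0_derive_le (fun x => x - sin x) (fun x => 1 - cos x) x x0.
by rewrite sin0 subr0; apply=> y; rewrite subr_ge0 cos_le1.
Qed.

Lemma sin_ge_cos x : 0 <= x <= pi / 2 -> x * cos x <= sin x.
Proof.
case/andP=> x0 xpi; rewrite -subr_ge0.
have := @ge0_derive_le (fun x => sin x - x * cos x) (fun x => x * sin x) x x0.
rewrite sin0 mul0r subr0; apply=> y.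
  by apply: is_derive_eq; rewrite /GRing.scale /=; ring.
case/andP=> y0 yx; rewrite mulr_ge0// sin_ge0_pi// y0 /=.
by have := @pi_ge0 R; lra.
Qed.

(** Doubling the angle: sin x = 2 cos(x/2) sin(x/2) >= x cos(x/2)^2, and
    cos(x/2)^2 >= 1/2 because x/2 <= pi/4. *)
Lemma sin_ge_half x : 0 <= x <= pi / 2 -> x / 2 <= sin x.
Proof.
case/andP=> x0 xpi; have pi0 := @pi_ge0 R.
have x2 : 0 <= x / 2 <= pi / 2 by lra.
have c2 : 0 <= cos (x / 2) by apply: cos_ge0_pihalf; lra.
have -> : sin x = 2 * (cos (x / 2) * sin (x / 2)).
  by rewrite -{1}[x](divfK (x := 2))// mulr_natr sin_mulr2n mulr_natl.
have cx : 1 / 2 <= cos (x / 2) ^+ 2.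
  have : 0 <= cos x by apply: cos_ge0_pihalf; lra.
  by rewrite -{1}[x](divfK (x := 2))// mulr_natr cos_mulr2n; lra.
have := ler_wpM2l c2 (sin_ge_cos x2).
suff : x / 2 * (1 / 2) <= x / 2 * cos (x / 2) ^+ 2 by lra.
by apply: ler_wpM2l => //; case/andP: x2.
Qed.

Lemma sinh2_ge x : x ^+ 2 <= sinh x ^+ 2.
Proof.
wlog x0 : x / 0 <= x => [h|]; last by rewrite ler_pXn2r ?nnegrE ?sinh_ge0 ?sinh_ge.
by have [/h//|x0] := leP 0 x; rewrite -sqrrN -(sqrrN (sinh x)) -sinhN h// oppr_ge0 ltW.
Qed.

Lemma sinh2_le x : sinh x ^+ 2 <= (x * cosh x) ^+ 2.
Proof.
wlog x0 : x / 0 <= x => [h|].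
  have [/h//|x0] := leP 0 x.
  by rewrite -sqrrN -(sqrrN (x * _)) -sinhN -mulNr -(coshN x) h// oppr_ge0 ltW.
by rewrite ler_pXn2r ?nnegrE ?sinh_ge0 ?sinh_le// mulr_ge0// ltW// cosh_gt0.
Qed.

Lemma sin2_le x : sin x ^+ 2 <= x ^+ 2.
Proof.
wlog x0 : x / 0 <= x => [h|].
  have [/h//|x0] := leP 0 x.
  by rewrite -sqrrN -(sqrrN x) -sinN h// oppr_ge0 ltW.
have [x1|x1] := leP x 1; last first.
  by rewrite (@le_trans _ _ 1)// ?exprn_ege1// ?ltW// sin2cos2 lerBlDr lerDl sqr_ge0.
rewrite ler_pXn2r ?nnegrE ?sin_le_id// sin_ge0_pi// x0 /=.
by have := @pi_ge2 R; lra.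
Qed.

Lemma sin2_ge x : `|x| <= pi / 2 -> (x * cos x) ^+ 2 <= sin x ^+ 2.
Proof.
wlog x0 : x / 0 <= x => [h|].
  have [/h//|x0 xpi] := leP 0 x.
  by rewrite -sqrrN -(sqrrN (sin x)) -sinN -mulNr -(cosN x) h// ?normrN// oppr_ge0 ltW.
rewrite ger0_norm// => xpi; have pi0 := @pi_ge0 R.
have c0 : 0 <= x * cos x by rewrite mulr_ge0// cos_ge0_pihalf//; lra.
have sx : x * cos x <= sin x by rewrite sin_ge_cos// x0.
by rewrite ler_pXn2r ?nnegrE// (le_trans c0).
Qed.

End Hyperbolic.

(** * Euler's product for cosh *)

Section Euler.
Variable R : realType.
Implicit Types (x y u v t : R).

Lemma cosh_mulS n x :
  cosh (n.+2%:R * x) = 2 * cosh x * cosh (n.+1%:R * x) - cosh (n%:R * x).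
Proof.
rewrite (_ : n.+2%:R * x = n.+1%:R * x + x); last by rewrite -!natr1; ring.
rewrite (_ : n%:R * x = n.+1%:R * x + - x); last by rewrite -!natr1; ring.
by rewrite !coshD coshN sinhN; ring.
Qed.

Lemma cos_mulS n x :
  cos (n.+2%:R * x) = 2 * cos x * cos (n.+1%:R * x) - cos (n%:R * x).
Proof.
rewrite (_ : n.+2%:R * x = n.+1%:R * x + x); last by rewrite -!natr1; ring.
rewrite (_ : n%:R * x = n.+1%:R * x + - x); last by rewrite -!natr1; ring.
by rewrite !cosD cosN sinN; ring.
Qed.

Lemma cos_double x : cos (2 * x) = 1 - 2 * sin x ^+ 2.
Proof. by rewrite mulr_natl cos_mulr2n cos2sin2; ring. Qed.

(** The polynomial with q(sin^2 x) = cos(2nx), a Chebyshev polynomial in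
    disguise. Since sin(iv)^2 = -(sinh v)^2, passing from cos to cosh is a change of sign
    of the argument. *)
Definition cheb_spec n (q : {poly R}) := [/\ (size (q : {poly R}) <= n.+1)%N,
  forall x, q.[sin x ^+ 2] = cos (n%:R * (2 * x)) &
  forall x, q.[- sinh x ^+ 2] = cosh (n%:R * (2 * x))].

Lemma cheb_exists n : exists q, cheb_spec n q.
Proof.
suff [q [_ [hq _]]] : exists q q', cheb_spec n q /\ cheb_spec n.+1 q' by exists q.
elim: n => [|n [q [q' [[s1 c1 h1] [s2 c2 h2]]]]].
  exists 1%:P, (1 - 2%:P * 'X); split; split=> [|x|x].
  - by rewrite size_polyC oner_eq0.
  - by rewrite hornerC mul0r cos0.
  - by rewrite hornerC mul0r cosh0.
  - rewrite (leq_trans (size_polyD _ _))// geq_max size_polyN size_polyC oner_eq0 /=.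
    by rewrite mul_polyC (leq_trans (size_scale_leq _ _))// size_polyX.
  - by rewrite mul1r cos_double !hornerE.
  - rewrite mul1r cosh_double; move: (sinh x ^+ 2) => z; rewrite !hornerE; ring.
exists q', (((2 : R)%:P - (4 : R)%:P * 'X) * q' - q); split=> //; split=> [|x|x].
- rewrite (leq_trans (size_polyD _ _))// geq_max size_polyN.
  rewrite (leq_trans s1) ?andbT; last by rewrite ltnW.
  rewrite (leq_trans (size_polyMleq _ _))//.
  have : (size ((2 : R)%:P - (4 : R)%:P * 'X)%R <= 2)%N.
    rewrite (leq_trans (size_polyD _ _))// geq_max size_polyN.
    rewrite (leq_trans (size_polyC_leq1 _))//=.
    by rewrite mul_polyC (leq_trans (size_scale_leq _ _))// size_polyX.
  by move: s2; move: (size _) (size _) => a b; lia.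
- rewrite cos_mulS cos_double -c1 -c2; move: (sin x ^+ 2) => z.
  by rewrite !hornerE; ring.
- rewrite cosh_mulS cosh_double -h1 -h2; move: (sinh x ^+ 2) => z.
  by rewrite !hornerE; ring.
Qed.

(** The positive zeros of cos; the zeros of the entire function cosh are
    +-i times them. *)
Definition cos_zero k : R := (2 * k%:R + 1) * (pi / 2).

Lemma cos_zero_gt0 k : 0 < cos_zero k.
Proof. by rewrite mulr_gt0 ?divr_gt0 ?pi_gt0// ltr_wpDl// mulr_ge0. Qed.

Lemma sin_natpi n : sin (n%:R * pi) = 0 :> R.
Proof.
elim: n => [|n IH]; first by rewrite mul0r sin0.
by rewrite -natr1 mulrDl mul1r sinD IH sinpi mul0r mulr0 addr0.
Qed.

Lemma cos_cos_zero k : cos (cos_zero k) = 0.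
Proof.
rewrite (_ : cos_zero k = k%:R * pi + pi / 2); last by rewrite /cos_zero; field.
by rewrite cosDpihalf sin_natpi oppr0.
Qed.

Lemma size_prod_affine (f : nat -> R) N :
  (size (\prod_(j < N) (1 - f j *: 'X))%R <= N.+1)%N.
Proof.
elim: N => [|N IH]; first by rewrite big_ord0 size_poly1.
rewrite big_ord_recr /= (leq_trans (size_polyMleq _ _))//.
have s2 : (size (1 - f N *: 'X)%R <= 2)%N.
  rewrite (leq_trans (size_polyD _ _))// geq_max size_polyN size_poly1 /=.
  by rewrite (leq_trans (size_scale_leq _ _))// size_polyX.
by move: IH s2; move: (size _) (size _) => a b; lia.
Qed.

Section FiniteProduct.
Variable N : nat.
Hypothesis N0 : (0 < N)%N.
Let tau (j : nat) : R := cos_zero j / (2 * N%:R).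

Let N0' : 0 < N%:R :> R. Proof. by rewrite ltr0n. Qed.

Lemma tau_bound j : (j < N)%N -> 0 < tau j < pi / 2.
Proof.
move=> jN; rewrite divr_gt0 ?cos_zero_gt0 ?mulr_gt0//=.
rewrite ltr_pdivrMr ?mulr_gt0// /cos_zero mulrC ltr_pM2l ?divr_gt0 ?pi_gt0//.
have h : (2 * j + 1 < 2 * N)%N by lia.
by move: h; rewrite -(ltr_nat R) natrD !natrM.
Qed.

Lemma sin_tau_gt0 j : (j < N)%N -> 0 < sin (tau j).
Proof. by move/tau_bound => /sin_gt0_pihalf. Qed.

Lemma sin2_tau_inj i j : (i < N)%N -> (j < N)%N ->
  sin (tau i) ^+ 2 = sin (tau j) ^+ 2 -> i = j.
Proof.
move=> iN jN /eqP; rewrite eqrXn2 ?ltW ?sin_tau_gt0// => /eqP /sin_inj.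
have /andP[i0 i1] := tau_bound iN; have /andP[j0 j1] := tau_bound jN.
rewrite !in_itv /= => h.
have pi0 := @pi_gt0 R.
have {h} : tau i = tau j by apply: h; lra.
rewrite /tau => /divIf; rewrite mulf_eq0 pnatr_eq0 /= gt_eqF// => /(_ isT).
rewrite /cos_zero => /mulIf; rewrite gt_eqF ?divr_gt0 ?pi_gt0// => /(_ isT).
by move=> /addIr /mulfI; rewrite pnatr_eq0 => /(_ isT) /eqP; rewrite eqr_nat => /eqP.
Qed.

(** Both sides are polynomials of degree at most N in -(sinh v)^2, and they
    agree at 0 and at the N zeros sin^2(tau j) of the left-hand one. *)
Lemma cosh_finite_prod v :
  cosh (2 * N%:R * v) = \prod_(j < N) (1 + (sinh v / sin (tau j)) ^+ 2).
Proof.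
have [q [sq cq hq]] := cheb_exists N.
pose w := \prod_(j < N) (1 - (sin (tau j) ^- 2) *: 'X) : {poly R}.
have hw x : w.[x] = \prod_(j < N) (1 - x / sin (tau j) ^+ 2).
  by rewrite horner_prod; apply: eq_bigr => j _; rewrite !hornerE mulrC.
have sw : (size w <= N.+1)%N by exact: (size_prod_affine (fun j => sin (tau j) ^- 2)).
suff qw : q = w.
  rewrite mulrAC mulrC -hq qw hw; apply: eq_bigr => j _.
  by rewrite mulNr opprK (expr_div_n (sinh v)).
apply/eqP; rewrite -subr_eq0; apply/negPn/negP => qw0.
pose rs : seq R := 0 :: [seq sin (tau j) ^+ 2 | j <- iota 0 N].
have : (size rs < size (q - w)%R)%N.
  apply: max_poly_roots => //.
    apply/andP; split.
      rewrite /root hornerD hornerN hw big1 ?subr_eq0; last first.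
        by move=> *; rewrite mul0r subr0.
      by have := cq 0; rewrite sin0 !mulr0 cos0 expr0n => /= ->.
    apply/allP => z /mapP[j]; rewrite mem_iota add0n => /andP[_ jN] ->.
    rewrite /root hornerD hornerN hw cq (bigD1 (Ordinal jN))//= divff; last first.
      by rewrite expf_eq0 /= gt_eqF// sin_tau_gt0.
    rewrite subrr mul0r subr0 (_ : _ * _ = cos_zero j) ?cos_cos_zero//.
    by rewrite /tau; field; rewrite gt_eqF.
  rewrite /= map_inj_in_uniq ?iota_uniq ?andbT.
    apply/negP => /mapP[j]; rewrite mem_iota add0n => /andP[_ jN] /eqP.
    by rewrite eq_sym expf_eq0 /= gt_eqF// sin_tau_gt0.
  move=> i j; rewrite !mem_iota !add0n => /andP[_ iN] /andP[_ jN].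
  exact: sin2_tau_inj.
rewrite /= size_map size_iota ltnNge (leq_trans (size_polyD _ _))// size_polyN.
by rewrite geq_max sq sw.
Qed.

End FiniteProduct.

(** Euler's product from below: in the finite product with K factors,
    sinh v >= v and sin tau <= tau. *)
Lemma prod_le_cosh K u : \prod_(j < K) (1 + (u / cos_zero j) ^+ 2) <= cosh u.
Proof.
have [->|K0] := posnP K; first by rewrite big_ord0 cosh_ge1.
have K0' : 0 < K%:R :> R by rewrite ltr0n.
have -> : u = 2 * K%:R * (u / (2 * K%:R)) by field; rewrite gt_eqF.
rewrite cosh_finite_prod//; apply: ler_prod => j _.
rewrite addr_ge0 ?sqr_ge0//= lerD2l.
have -> : 2 * K%:R * (u / (2 * K%:R)) / cos_zero j =
          (u / (2 * K%:R)) / (cos_zero j / (2 * K%:R)).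
  by field; rewrite !gt_eqF ?cos_zero_gt0.
set t := cos_zero j / _; set v := u / _.
have t0 : 0 < t by rewrite divr_gt0 ?cos_zero_gt0 ?mulr_gt0.
have s0 : 0 < sin t := sin_tau_gt0 K0 (ltn_ord j).
rewrite (expr_div_n v) (expr_div_n (sinh v)).
apply: ler_pM; rewrite ?sqr_ge0 ?invr_ge0 ?sqr_ge0 ?sinh2_ge//.
by rewrite lef_pV2 ?posrE ?exprn_gt0// sin2_le.
Qed.

Lemma cvg_div_nat (c : R) : c / (2 * n%:R) @[n --> \oo] --> (0 : R).
Proof.
rewrite -[X in _ --> X](mulr0 (c / 2)).
rewrite (_ : (fun n => _) = fun n => (c / 2) * n%:R^-1); last first.
  by apply/funext => n; rewrite invfM mulrA.
apply: cvgMl_tmp; rewrite -(cvg_shiftS (fun n : nat => n%:R^-1 : R)).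
exact: cvg_harmonic.
Qed.

Lemma cos_zero_ge k : 2 * k%:R + 1 <= cos_zero k.
Proof. by rewrite ler_peMr ?pihalf_ge1// addr_ge0// mulr_ge0. Qed.

(** Bound for the factors with fixed j: the correcting square tends to 1 as N
    grows. *)
Lemma sinh_div_sin_le N j u : (j < N)%N ->
  (sinh (u / (2 * N%:R)) / sin (cos_zero j / (2 * N%:R))) ^+ 2 <=
  (u / cos_zero j) ^+ 2 *
  (cosh (u / (2 * N%:R)) / cos (cos_zero j / (2 * N%:R))) ^+ 2.
Proof.
move=> jN; have N0 : (0 < N)%N by case: N jN.
have N0' : 0 < N%:R :> R by rewrite ltr0n.
have z0 := cos_zero_gt0 j; have s0 := sin_tau_gt0 N0 jN.
have /andP[t0 tpi] := tau_bound N0 jN.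
have -> : u / cos_zero j = (u / (2 * N%:R)) / (cos_zero j / (2 * N%:R)).
  by field; rewrite !gt_eqF.
move: t0 tpi s0; set t := cos_zero j / _; set v := u / _ => t0 tpi s0.
have c0 : 0 < cos t by apply: cos_gt0_pihalf; have := @pi_gt0 R; lra.
have -> : (v / t) ^+ 2 * (cosh v / cos t) ^+ 2 = (v * cosh v / (t * cos t)) ^+ 2.
  by rewrite -exprMn mulf_div.
rewrite (expr_div_n (sinh v)) (expr_div_n (v * _)).
apply: ler_pM; rewrite ?sqr_ge0 ?invr_ge0 ?sqr_ge0 ?sinh2_le//.
have tc : 0 < t * cos t by exact: mulr_gt0.
rewrite lef_pV2 ?posrE ?exprn_gt0// ler_pXn2r ?nnegrE ?(ltW tc) ?(ltW s0)//.
by apply: sin_ge_cos; rewrite !ltW.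
Qed.

(** Bound for the tail, uniform in N and telescoping in j. The constant 8 comes
    from sin x >= x/2 and (2j+1)^2 >= (j+1)(j+2)/2. *)
Lemma sinh_div_sin_le_tele N j u : (j < N)%N ->
  (sinh (u / (2 * N%:R)) / sin (cos_zero j / (2 * N%:R))) ^+ 2 <=
  8 * (u * cosh u) ^+ 2 * (j.+1%:R^-1 - j.+2%:R^-1).
Proof.
move=> jN; have N0 : (0 < N)%N by case: N jN.
have N0' : 0 < N%:R :> R by rewrite ltr0n.
have z0 := cos_zero_gt0 j; have s0 := sin_tau_gt0 N0 jN.
have /andP[t0 tpi] := tau_bound N0 jN.
set t := cos_zero j / _ in t0 tpi s0 *; set v := u / _.
have cv : cosh v <= cosh u.
  have cn (w : R) : cosh w = cosh `|w| by case: ger0P => _; rewrite ?coshN.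
  rewrite (cn v) (cn u) cosh_homo// normrM ler_piMr// normfV.
  rewrite gtr0_norm ?mulr_gt0// invf_le1 ?mulr_gt0//.
  by rewrite -natrM ler1n muln_gt0.
have st : t / 2 <= sin t by apply: sin_ge_half; rewrite !ltW.
have : (sinh v / sin t) ^+ 2 <= (v * cosh u / (t / 2)) ^+ 2.
  rewrite (expr_div_n (sinh v)) (expr_div_n (v * _)).
  apply: ler_pM; rewrite ?sqr_ge0 ?invr_ge0 ?sqr_ge0//.
    apply: le_trans (sinh2_le _) _; move: (cosh_gt0 v) cv.
    move: v (cosh v) (cosh u) => w a b a0 ab.
    by rewrite !exprMn ler_wpM2l ?sqr_ge0// ler_pXn2r ?nnegrE//; lra.
  have t2 : 0 < t / 2 by exact: divr_gt0.
  by rewrite lef_pV2 ?posrE ?exprn_gt0// ler_pXn2r ?nnegrE ?(ltW t2) ?(ltW s0).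
move=> h; apply: (le_trans h).
have -> : v * cosh u / (t / 2) = u * cosh u * (2 / cos_zero j).
  by rewrite /v /t; field; rewrite !gt_eqF.
rewrite [leLHS]exprMn [leRHS]mulrAC [leRHS]mulrC ler_wpM2l ?sqr_ge0//.
have -> : 8 * (j.+1%:R^-1 - j.+2%:R^-1) = 8 / (j.+1%:R * j.+2%:R) :> R.
  by rewrite -!natr1; field; rewrite !natr1 ?pnatr_eq0.
rewrite expr_div_n ler_pdivrMr ?exprn_gt0// mulrAC ler_pdivlMr ?mulr_gt0//.
have := cos_zero_ge j; rewrite -!natr1; have : 0 <= j%:R :> R by [].
move: (j%:R) (cos_zero j) => x y x0 xy.
have xy2 : (2 * x + 1) ^+ 2 <= y ^+ 2 by rewrite ler_pXn2r ?nnegrE//; lra.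
have : 0 <= x ^+ 2 by exact: sqr_ge0.
by move: xy2; rewrite !expr2; lra.
Qed.

(** Euler's product from above, with an explicit error: in the finite product
    with N factors, the first K converge as N grows and the others contribute
    at most the exponential of a telescoping sum. *)
Lemma cosh_le_prod K u : cosh u <=
  \prod_(j < K) (1 + (u / cos_zero j) ^+ 2) *
  expR (8 * (u * cosh u) ^+ 2 / K.+1%:R).
Proof.
set E := expR _.
pose F (N : nat) := \prod_(j < K) (1 + (u / cos_zero j) ^+ 2 *
   (cosh (u / (2 * N%:R)) / cos (cos_zero j / (2 * N%:R))) ^+ 2) * E.
have -> : \prod_(j < K) (1 + (u / cos_zero j) ^+ 2) =
    \prod_(j < K) (1 + (u / cos_zero j) ^+ 2 * (cosh 0 / cos 0) ^+ 2).
  by rewrite cosh0 cos0 divr1 expr1n; apply: eq_bigr => j _; rewrite mulr1.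
set P := \prod_(j < K) _.
have cF : F n @[n --> \oo] --> P * E.
  apply: cvgMr_tmp; apply: cvg_big => [|j _]; first exact: mul_continuous.
  apply: cvgD; first exact: cvg_cst.
  apply: cvgMl_tmp.
  have cq : cosh (u / (2 * N%:R)) / cos (cos_zero j / (2 * N%:R)) @[N --> \oo]
      --> cosh 0 / cos 0.
    apply: cvgM.
      by apply: continuous_cvg; [exact: continuous_cosh|exact: cvg_div_nat].
    apply: cvgV; first by rewrite cos0 oner_neq0.
    by apply: continuous_cvg; [exact: continuous_cos|exact: cvg_div_nat].
  by rewrite expr2; under eq_fun do rewrite expr2; apply: cvgM.
apply: (cvgr_to_ge cF); near=> N.
have KN : (K < N)%N by near: N; exact: nbhs_infty_gt.
have N0 : (0 < N)%N by case: (N) KN.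
have N0' : N%:R != 0 :> R by rewrite pnatr_eq0 -lt0n.
rewrite {1}(_ : u = 2 * N%:R * (u / (2 * N%:R))); last by field.
rewrite cosh_finite_prod//; set v := u / _.
rewrite -(big_mkord xpredT (fun j => 1 + (sinh v / sin (cos_zero j / (2 * N%:R))) ^+ 2)).
rewrite (big_cat_nat (n := K)) ?(ltnW KN)//= big_mkord.
apply: ler_pM.
- by apply: prodr_ge0 => j _; rewrite addr_ge0 ?sqr_ge0.
- by apply: prodr_ge0 => j _; rewrite addr_ge0 ?sqr_ge0.
- apply: ler_prod => j _; rewrite addr_ge0 ?sqr_ge0//= lerD2l.
  by apply: sinh_div_sin_le; exact: ltn_trans KN.
- apply: (@le_trans _ _ (expR (\sum_(K <= j < N)
    (8 * (u * cosh u) ^+ 2 * (j.+1%:R^-1 - j.+2%:R^-1))))).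
    rewrite expR_sum [leLHS]big_nat_cond [leRHS]big_nat_cond.
    apply: ler_prod => j; rewrite andbT => /andP[_ jN].
    rewrite addr_ge0 ?sqr_ge0//= (le_trans _ (expR_ge1Dx _))// lerD2l.
    exact: sinh_div_sin_le_tele.
  rewrite ler_expR -mulr_sumr ler_wpM2l ?(mulr_ge0 _ (sqr_ge0 _))//.
  rewrite (eq_bigr (fun j => (- j.+2%:R^-1) - (- j.+1%:R^-1))); last first.
    by move=> j _; rewrite opprK addrC.
  rewrite (telescope_sumr (fun j : nat => - (j.+1%:R^-1) : R) (ltnW KN)) opprK.
  by rewrite gerDr oppr_le0 invr_ge0.
Unshelve. all: by end_near. Qed.

Definition lncosh u : R := ln (cosh u).

Lemma lncosh_prod_le K u :
  \sum_(j < K) ln (1 + (u / cos_zero j) ^+ 2) <= lncosh u.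
Proof.
have p0 (j : 'I_K) : 0 < 1 + (u / cos_zero j) ^+ 2 by rewrite ltr_pwDl// sqr_ge0.
rewrite -ler_expR expR_sum lnK ?posrE ?cosh_gt0//.
under eq_bigr do rewrite lnK ?posrE//.
exact: prod_le_cosh.
Qed.

Lemma lncosh_le_prod K u :
  lncosh u - 8 * (u * cosh u) ^+ 2 / K.+1%:R <=
  \sum_(j < K) ln (1 + (u / cos_zero j) ^+ 2).
Proof.
have p0 (j : 'I_K) : 0 < 1 + (u / cos_zero j) ^+ 2 by rewrite ltr_pwDl// sqr_ge0.
rewrite lerBlDr -ler_expR expRD expR_sum lnK ?posrE ?cosh_gt0//.
under eq_bigr do rewrite lnK ?posrE//.
exact: cosh_le_prod.
Qed.

End Euler.

(** * The logarithm of the Poisson kernel *)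

Section LogSeries.
Variable R : realType.
Implicit Types (x y u v t : R).

Lemma cos_geometric M c x : (1 - 2 * x * cos c + x ^+ 2) *
  \sum_(n < M) x ^+ n * cos (n.+1%:R * c) =
  cos c - x - x ^+ M * cos (M.+1%:R * c) + x ^+ M.+1 * cos (M%:R * c).
Proof.
elim: M => [|M IH].
  by rewrite big_ord0 mulr0 mul0r cos0 !mul1r expr1; ring.
rewrite big_ord_recr /= mulrDr IH cos_mulS.
by rewrite !exprS; ring.
Qed.

Lemma poisson_denom_ge x c : 0 <= x -> (1 - x) ^+ 2 <= 1 - 2 * x * cos c + x ^+ 2.
Proof.
move=> x0; rewrite -subr_ge0.
rewrite (_ : _ - _ = 2 * (x * (1 - cos c))); last by ring.
by rewrite mulr_ge0// mulr_ge0// subr_ge0 cos_le1.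
Qed.

Definition cos_series M c x : R :=
  \sum_(n < M) 2 / n.+1%:R * x ^+ n.+1 * cos (n.+1%:R * c).

Lemma is_derive_cos_series M c x : is_derive x 1 (cos_series M c)
  (2 * \sum_(n < M) x ^+ n * cos (n.+1%:R * c)).
Proof.
elim: M => [|M IH].
  rewrite big_ord0 mulr0 (_ : cos_series 0 c = cst 0); first exact: is_derive_cst.
  by apply/funext => y; rewrite /cos_series big_ord0.
rewrite big_ord_recr /= (_ : cos_series M.+1 c = fun y => cos_series M c y +
  2 / M.+1%:R * y ^+ M.+1 * cos (M.+1%:R * c)); last first.
  by apply/funext => y; rewrite /cos_series big_ord_recr.
have hX : is_derive x 1 (fun y : R => y ^+ M.+1) (M.+1%:R * x ^+ M).
  have := @is_deriveX _ _ (@id R) M.+1 x 1 1 (is_derive_id x 1).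
  by rewrite exprfctE /GRing.scale /= mulr1.
have := is_deriveD IH (is_deriveZ (2 / M.+1%:R * cos (M.+1%:R * c)) hX).
rewrite (_ : cos_series M c + _ = fun y => cos_series M c y +
  2 / M.+1%:R * y ^+ M.+1 * cos (M.+1%:R * c)); last first.
  apply/funext => y.
  transitivity (cos_series M c y + 2 / M.+1%:R * cos (M.+1%:R * c) * y ^+ M.+1) => //.
  by rewrite mulrAC.
move=> h; apply: (is_derive_eq h); rewrite /GRing.scale /= mulrDr; congr (_ + _).
by field; rewrite nat1r pnatr_eq0.
Qed.

Lemma is_derive_ln_poisson c x : 0 <= x < 1 ->
  is_derive x 1 (fun y => ln (1 - 2 * y * cos c + y ^+ 2))
    ((2 * x - 2 * cos c) / (1 - 2 * x * cos c + x ^+ 2)).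
Proof.
move=> /andP[x0 x1].
have p0 : 0 < 1 - 2 * x * cos c + x ^+ 2.
  by rewrite (lt_le_trans _ (poisson_denom_ge _ x0))// exprn_gt0// subr_gt0.
have d : is_derive x 1 (fun y : R => 1 - 2 * y * cos c + y ^+ 2) (2 * x - 2 * cos c).
  rewrite (_ : (fun y => _) = fun y => 1 - 2 * y * cos c + y * y) => [|]; last first.
    by apply/funext => y; rewrite expr2.
  by apply: is_derive_eq; rewrite /GRing.scale /=; ring.
have l := is_derive1_ln p0.
rewrite mulrC; exact: (is_derive1_comp (f := @ln R)
  (g := fun y : R => 1 - 2 * y * cos c + y ^+ 2) l d).
Qed.

(** For 0 <= x < 1 the derivative in x of the left-hand side is a closed form
    with a factor x^M ([cos_geometric]), and both terms vanish at x = 0. *)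
Lemma cos_series_bound M c x : 0 <= x < 1 ->
  `|cos_series M c x + ln (1 - 2 * x * cos c + x ^+ 2)| <= 4 * x ^+ M / (1 - x) ^+ 2.
Proof.
move=> /andP[x0 x1].
pose f y := cos_series M c y + ln (1 - 2 * y * cos c + y ^+ 2).
pose df y := 2 * \sum_(n < M) y ^+ n * cos (n.+1%:R * c) +
  (2 * y - 2 * cos c) / (1 - 2 * y * cos c + y ^+ 2).
have fd y : 0 <= y < 1 -> is_derive y 1 f (df y).
  move=> y01; apply: is_deriveD; first exact: is_derive_cos_series.
  exact: is_derive_ln_poisson.
have f0 : f 0 = 0.
  rewrite /f mulr0 mul0r subr0 expr0n addr0 ln1 addr0 /cos_series big1// => n _.
  by rewrite expr0n mulr0 mul0r.
have cf : {within `[0, x], continuous f}.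
  apply: continuous_in_subspaceT => y; rewrite inE/= in_itv/= => /andP[y0 yx].
  apply/differentiable_continuous/derivable1_diffP.
  have h : 0 <= y < 1 by rewrite y0 (le_lt_trans yx).
  by have [] := fd y h.
have fd' y : y \in `]0, x[ -> is_derive y 1 f (df y).
  by rewrite in_itv/= => /andP[y0 yx]; apply: fd; rewrite ltW//= (lt_trans yx).
have [y] := MVT_segment x0 fd' cf.
rewrite in_itv/= => /andP[y0 yx]; rewrite f0 !subr0 -/(f x) => ->.
have y1 : y < 1 by exact: le_lt_trans x1.
have p1 : 0 < (1 - x) ^+ 2 by rewrite exprn_gt0// subr_gt0.
have p2 : (1 - x) ^+ 2 <= 1 - 2 * y * cos c + y ^+ 2.
  by apply: le_trans (poisson_denom_ge _ y0); rewrite ler_pXn2r ?nnegrE//; lra.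
have p3 := lt_le_trans p1 p2.
have -> : df y = 2 * (y ^+ M.+1 * cos (M%:R * c) - y ^+ M * cos (M.+1%:R * c)) /
                 (1 - 2 * y * cos c + y ^+ 2).
  apply: (mulIf (lt0r_neq0 p3)); rewrite mulfVK ?gt_eqF// mulrDl mulfVK ?gt_eqF//.
  have := cos_geometric M c y; move: (\sum_(n < M) _) => B e.
  rewrite (_ : 2 * B * _ = 2 * ((1 - 2 * y * cos c + y ^+ 2) * B)); last by ring.
  by rewrite e; ring.
rewrite !normrM (ger0_norm x0) normfV (gtr0_norm p3) ger0_norm//.
have yM : y ^+ M <= x ^+ M by rewrite lerXn2r ?nnegrE.
have q1 : `|y ^+ M.+1 * cos (M%:R * c) - y ^+ M * cos (M.+1%:R * c)| <= 2 * x ^+ M.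
  rewrite (le_trans (ler_normB _ _))// !normrM !normrX (ger0_norm y0) mulrDl !mul1r.
  rewrite lerD// (le_trans (ler_wpM2l _ (cos_max _))) ?mulr1 ?exprn_ge0//.
  by rewrite (le_trans _ yM)// exprS ler_piMl ?exprn_ge0// ltW.
have x2 := ltW x1.
rewrite (@le_trans _ _ (2 * (2 * x ^+ M) / (1 - x) ^+ 2))//; last first.
  by rewrite mulrA (_ : 2 * 2 = 4) //; ring.
apply: (@le_trans _ _ (2 * `|y ^+ M.+1 * cos (M%:R * c) -
    y ^+ M * cos (M.+1%:R * c)| / (1 - 2 * y * cos c + y ^+ 2))).
  by rewrite ler_piMr// divr_ge0 ?mulr_ge0// (ltW p3).
apply: ler_pM; rewrite ?mulr_ge0 ?invr_ge0 ?(ltW p3)//; first by rewrite ler_pM2l.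
by rewrite lef_pV2.
Qed.

Lemma cos_series_cvg c x : 0 <= x < 1 ->
  cos_series M c x @[M --> \oo] --> - ln (1 - 2 * x * cos c + x ^+ 2).
Proof.
move=> x01; apply/subr_cvg0; apply/norm_cvg0P.
have b0 : 4 * x ^+ M / (1 - x) ^+ 2 @[M --> \oo] --> (0 : R).
  suff : 4 * x ^+ M / (1 - x) ^+ 2 @[M --> \oo] --> 4 * 0 / (1 - x) ^+ 2.
    by rewrite mulr0 mul0r.
  apply: cvgMr_tmp; apply: cvgMl_tmp; apply: cvg_expr.
  by case/andP: x01 => x0 x1; rewrite ger0_norm.
apply: (squeeze_cvgr _ (cvg_cst 0) b0); near=> M.
by rewrite normr_ge0 opprK cos_series_bound.
Unshelve. all: by end_near. Qed.

Definition poisson_series M x c : R :=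
  \sum_(n < M) 2 / n.+1%:R * x ^+ n.+1 * (1 - cos (n.+1%:R * c)).

(** The logarithm of (1 - 2x cos c + x^2) / (1 - x)^2, the inverse of the
    Poisson kernel normalized to 1 at c = 0. *)
Definition poisson_log x c : R := ln (1 + 2 * x * (1 - cos c) / (1 - x) ^+ 2).

Lemma poisson_series_cvg x c : 0 <= x < 1 ->
  poisson_series M x c @[M --> \oo] --> poisson_log x c.
Proof.
move=> x01; have /andP[x0 x1] := x01.
have d0 : 0 < (1 - x) ^+ 2 by rewrite exprn_gt0// subr_gt0.
have dc := lt_le_trans d0 (poisson_denom_ge c x0).
have -> : poisson_log x c =
    - ln (1 - 2 * x * cos 0 + x ^+ 2) - - ln (1 - 2 * x * cos c + x ^+ 2).
  rewrite opprK addrC cos0 mulr1 (_ : 1 - 2 * x + x ^+ 2 = (1 - x) ^+ 2); last by ring.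
  by rewrite -ln_div ?posrE//; congr ln; field; rewrite subr_eq0 eq_sym lt_eqF.
rewrite (_ : (fun M => _) = fun M => cos_series M 0 x - cos_series M c x); last first.
  apply/funext => M; rewrite /poisson_series /cos_series -sumrB.
  by apply: eq_bigr => n _; rewrite mulr0 cos0; ring.
by apply: cvgB; exact: cos_series_cvg.
Qed.

Lemma poisson_series_ndecr x c : 0 <= x ->
  nondecreasing_seq (fun M => poisson_series M x c).
Proof.
move=> x0; apply/nondecreasing_seqP => M; rewrite /poisson_series big_ord_recr /=.
by rewrite lerDl !mulr_ge0 ?exprn_ge0// subr_ge0 cos_le1.
Qed.

Lemma poisson_series_le M x c : 0 <= x < 1 ->
  poisson_series M x c <= poisson_log x c.
Proof.
move=> x01; have /andP[x0 _] := x01.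
have cp := @poisson_series_cvg x c x01.
rewrite -(cvg_lim _ cp)//; apply: nondecreasing_cvgn_le; last exact: cvgP cp.
exact: poisson_series_ndecr.
Qed.

(** With x = exp(-b), the quotient (1 - x)^2 / x is 4 sinh(b/2)^2. *)
Lemma poisson_log_expR b c : 0 < b ->
  poisson_log (expR (- b)) c = ln (1 + (sin (c / 2) / sinh (b / 2)) ^+ 2).
Proof.
move=> b0; rewrite /poisson_log; congr (ln (1 + _)).
have -> : cos c = 1 - 2 * sin (c / 2) ^+ 2.
  by rewrite -cos_double; congr cos; field.
have s0 : 0 < sinh (b / 2) by rewrite sinh_gt0// divr_gt0.
have -> : expR (- b) = expR (- (b / 2)) ^+ 2.
  by rewrite -expRM_natl; congr expR; field.
have e0 : expR (- (b / 2)) != 0 by rewrite gt_eqF// expR_gt0.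
have -> : 1 - expR (- (b / 2)) ^+ 2 = 2 * expR (- (b / 2)) * sinh (b / 2).
  have h : expR (b / 2) * expR (- (b / 2)) = 1 by rewrite expRxMexpNx_1.
  by rewrite sinhE -[X in X - _]h; field.
rewrite expr_div_n; field.
by rewrite e0 gt_eqF.
Qed.

End LogSeries.

(** * Contractive Schur multipliers and Levy exponents *)

Local Open Scope sesquilinear_scope.
Local Open Scope complex_scope.

Section SchurMultipliers.
Variable R : realType.
Local Notation C := R[i].

Definition schur n (K : 'I_n -> 'I_n -> R) (X : 'M[C]_n) : 'M[C]_n :=
  map2_mx *%R (\matrix_(i, j) (K i j)%:C) X.

Section Norm.
Variables (n : nat) (N : 'M[C]_n -> R).
Hypothesis HN : unitarily_invariant_norm N.
Implicit Types (K : 'I_n -> 'I_n -> R) (X Y : 'M[C]_n).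

Lemma uin0 : N 0 = 0.
Proof.
rewrite -[0 in LHS](scale0r (0 : 'M[C]_n)) (uin_scale HN).
by rewrite /= expr0n addr0 sqrtr0 mul0r.
Qed.

Lemma uinZ (c : R) X : N (c%:C *: X) = `|c| * N X.
Proof. by rewrite (uin_scale HN) /= expr0n addr0 sqrtr_sqr. Qed.

Lemma uinN X : N (- X) = N X.
Proof. by rewrite -scaleN1r -(rmorphN1 (real_complex R)) uinZ normrN1 mul1r. Qed.

Lemma uin_sum (I : Type) (r : seq I) (P : pred I) (F : I -> 'M[C]_n) :
  N (\sum_(i <- r | P i) F i) <= \sum_(i <- r | P i) N (F i).
Proof.
elim/big_ind2 : _ => [|x1 x2 y1 y2 h1 h2|//]; first by rewrite uin0.
by apply: le_trans (uin_triangle HN _ _) _; rewrite lerD.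
Qed.

Lemma uin_dist X Y : `|N X - N Y| <= N (X - Y).
Proof.
have H (A B : 'M[C]_n) : N A - N B <= N (A - B).
  by rewrite lerBlDr -{1}[A](subrK B) (uin_triangle HN).
by rewrite ler_norml H andbT lerNl opprB -(uinN (X - Y)) opprB H.
Qed.

(** A unitarily invariant norm is bounded by a weighted sum of the moduli of
    the entries, hence continuous for entrywise convergence. *)
Lemma schur_norm_cvg (K : nat -> 'I_n -> 'I_n -> R) K0 X :
  (forall i j, K k i j @[k --> \oo] --> K0 i j) ->
  N (schur (K k) X) @[k --> \oo] --> N (schur K0 X).
Proof.
move=> cK.
pose e k := \sum_i \sum_j `|K k i j - K0 i j| * N (X i j *: delta_mx i j).
have e0 : e k @[k --> \oo] --> (0 : R).
  rewrite [X in _ --> X](_ : _ = \sum_(i < n) \sum_(j < n)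
      `|K0 i j - K0 i j| * N (X i j *: delta_mx i j)); last first.
    by rewrite big1// => i _; rewrite big1// => j _; rewrite subrr normr0 mul0r.
  apply: cvg_big => [|i _]; first exact: add_continuous.
  apply: cvg_big => [|j _]; first exact: add_continuous.
  apply: cvgMr_tmp; apply: cvg_norm; apply: cvgB; [exact: cK|exact: cvg_cst].
apply/subr_cvg0; apply/norm_cvg0P; apply: (squeeze_cvgr _ (cvg_cst 0) e0); near=> k.
  rewrite normr_ge0 /= (le_trans (uin_dist _ _))//.
  rewrite (matrix_sum_delta (_ - _)) (le_trans (uin_sum _ _ _))//.
  apply: ler_sum => i _; rewrite (le_trans (uin_sum _ _ _))//.
  apply: ler_sum => j _; rewrite !mxE -mulrBl -rmorphB -scalerA uinZ.
  by rewrite /=.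
Unshelve. all: by end_near. Qed.

Lemma schurM K L X : schur K (schur L X) = schur (fun i j => K i j * L i j) X.
Proof. by apply/matrixP => i j; rewrite !mxE mulrA rmorphM. Qed.

Lemma schurD K L X : schur (fun i j => K i j + L i j) X = schur K X + schur L X.
Proof. by apply/matrixP => i j; rewrite !mxE rmorphD mulrDl. Qed.

End Norm.

(** The values f(x_i - y_j) rather than f(x_i - x_j) are used because the two
    sides of X carry different spectra. The constant f 0 makes the class a cone. *)
Definition contractive (f : R -> R) : Prop :=
  0 <= f 0 /\ forall n (N : 'M[C]_n -> R) (x y : 'I_n -> R) (X : 'M[C]_n),
    unitarily_invariant_norm N ->
    N (schur (fun i j => f (x i - y j)) X) <= f 0 * N X.

Lemma contractive_ext f g : f =1 g -> contractive f -> contractive g.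
Proof. by move=> /funext ->. Qed.

Lemma contractive_cvg (F : nat -> R -> R) (f : R -> R) : (forall k, contractive (F k)) ->
  (forall u, F k u @[k --> \oo] --> f u) -> contractive f.
Proof.
move=> cF Ff; split; first by apply: (cvgr_to_ge (Ff 0)); near=> k; case: (cF k).
move=> n N x y X HN.
have cl := @schur_norm_cvg _ _ HN (fun k i j => F k (x i - y j))
  (fun i j => f (x i - y j)) X (fun i j => Ff _).
apply: (ler_cvg_to cl (cvgMr_tmp (b := N X) (Ff 0))).
by near=> k; have [_] := cF k; apply.
Unshelve. all: by end_near. Qed.

Lemma contractive_cst c : 0 <= c -> contractive (fun=> c).
Proof.
move=> c0; split=> // n N x y X HN.
rewrite (_ : schur _ X = c%:C *: X) ?(uinZ HN) ?ger0_norm//.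
by apply/matrixP => i j; rewrite !mxE.
Qed.

Lemma contractiveD f g : contractive f -> contractive g ->
  contractive (fun u => f u + g u).
Proof.
move=> [f0 cf] [g0 cg]; split=> [|n N x y X HN]; first exact: addr_ge0.
by rewrite schurD (le_trans (uin_triangle HN _ _))// mulrDl lerD ?cf ?cg.
Qed.

Lemma contractiveM f g : contractive f -> contractive g ->
  contractive (fun u => f u * g u).
Proof.
move=> [f0 cf] [g0 cg]; split=> [|n N x y X HN]; first exact: mulr_ge0.
by rewrite -schurM (le_trans (cf _ _ _ _ _ HN))// -mulrA ler_wpM2l ?cg.
Qed.

Lemma contractiveZ c f : 0 <= c -> contractive f -> contractive (fun u => c * f u).
Proof. by move=> c0; apply: contractiveM; exact: contractive_cst. Qed.

Lemma contractiveX f k : contractive f -> contractive (fun u => f u ^+ k).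
Proof.
move=> cf; elim: k => [|k IH].
  by apply: (@contractive_ext (fun=> 1)); [|exact: contractive_cst].
by apply: (contractive_ext _ (contractiveM cf IH)) => u; rewrite exprS.
Qed.

Lemma contractive_power_series (a : nat -> R) f g : (forall k, 0 <= a k) ->
    contractive f ->
    (forall u, series (fun k => a k * f u ^+ k) k @[k --> \oo] --> g u) ->
  contractive g.
Proof.
move=> a0 cf; apply: contractive_cvg => k; rewrite /series /=.
elim: k => [|k IH].
  by apply: (@contractive_ext (fun=> 0)) => [u|]; [rewrite big_geq|exact: contractive_cst].
have := contractiveD IH (contractiveZ (a0 k) (contractiveX k cf)).
by apply: contractive_ext => u; rewrite big_nat_recr.
Qed.

Lemma contractive_comp_mul c f : contractive f -> contractive (fun u => f (c * u)).
Proof.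
move=> [f0 cf]; split=> [|n N x y X HN]; first by rewrite mulr0.
rewrite mulr0; apply: le_trans (cf _ _ (fun i => c * x i) (fun j => c * y j) _ HN).
by under [X in schur X]eq_fun do under eq_fun do rewrite mulrBr.
Qed.

Definition phase (t : R) : C := cos t +i* sin t.

Lemma phaseD s t : phase (s + t) = phase s * phase t.
Proof.
by rewrite /phase cosD sinD addrC [X in _ +i* X]addrC; congr Complex; rewrite addrC.
Qed.

Lemma phaseJ t : ((phase t)^*)%R = phase (- t).
Proof. by rewrite /phase cosN sinN. Qed.

Definition phasemx n (x : 'I_n -> R) : 'M[C]_n := diag_mx (\row_i phase (x i)).

Lemma phasemx_unitary n (x : 'I_n -> R) : phasemx x \is unitarymx.
Proof.
apply/unitarymxP/matrixP => i j; rewrite mul_diag_mx !mxE eq_sym.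
have [->|_] := eqVneq i j; last by rewrite mulr0n conjC0 mulr0.
by rewrite mulr1n [X in _ * X]phaseJ -phaseD subrr /phase cos0 sin0.
Qed.

(** Since cos(x - y) is the mean of e^(ix) e^(-iy) and e^(-ix) e^(iy), the
    multiplier is the mean of two multiplications by diagonal unitaries. *)
Lemma contractive_cos : contractive (@cos R).
Proof.
rewrite /contractive cos0; split=> // n N x y X HN.
have -> : schur (fun i j => cos (x i - y j)) X =
    2^-1%:C *: (phasemx x *m X *m phasemx (fun j => - y j) +
                phasemx (fun i => - x i) *m X *m phasemx y).
  apply/matrixP => i j; rewrite /phasemx !(mul_mx_diag, mul_diag_mx) !mxE.
  rewrite mulrAC -phaseD [phase (- x i) * _ * _]mulrAC -phaseD -mulrDl mulrA.
  congr (_ * _); rewrite [- x i + _]addrC -[y j - x i]opprB.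
  move: (x i - y j) => t.
  rewrite /phase cosN sinN [in RHS]/GRing.add /= [in RHS]/GRing.mul /=.
  by congr Complex; field.
rewrite (uinZ HN) mul1r gtr0_norm ?invr_gt0// ler_pdivrMl// mulr_natl mulr2n.
apply: le_trans (uin_triangle HN _ _) _.
by rewrite !(uin_unitary HN) ?phasemx_unitary.
Qed.

(** Negative definite functions, described by the semigroup exp(-t psi) they
    generate. *)
Definition levy_exponent (psi : R -> R) : Prop :=
  forall t, 0 <= t -> contractive (fun u => expR (- (t * psi u))).

Lemma levy_exponent_ext f g : f =1 g -> levy_exponent f -> levy_exponent g.
Proof. by move=> /funext ->. Qed.

Lemma levy_exponent_cvg (F : nat -> R -> R) (f : R -> R) : (forall k, levy_exponent (F k)) ->
  (forall u, F k u @[k --> \oo] --> f u) -> levy_exponent f.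
Proof.
move=> lF Ff t t0; apply: (contractive_cvg (fun k => lF k t t0)) => u.
apply: continuous_cvg; first exact: continuous_expR.
by apply: cvgN; apply: cvgMl_tmp.
Qed.

Lemma levy_exponentD f g : levy_exponent f -> levy_exponent g ->
  levy_exponent (fun u => f u + g u).
Proof.
move=> lf lg t t0; apply: contractive_ext (contractiveM (lf t t0) (lg t t0)) => u.
by rewrite mulrDr opprD expRD.
Qed.

Lemma levy_exponentZ c f : 0 <= c -> levy_exponent f ->
  levy_exponent (fun u => c * f u).
Proof.
move=> c0 lf t t0; apply: contractive_ext (lf _ (mulr_ge0 t0 c0)) => u.
by rewrite mulrA.
Qed.

Lemma levy_exponent_sum (I : Type) (r : seq I) (F : I -> R -> R) :
  (forall i, levy_exponent (F i)) -> levy_exponent (fun u => \sum_(i <- r) F i u).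
Proof.
move=> lF; elim: r => [|i r IH].
  move=> t t0; apply: (@contractive_ext (fun=> 1)); last exact: contractive_cst.
  by move=> u; rewrite big_nil mulr0 oppr0 expR0.
by apply: levy_exponent_ext (levy_exponentD (lF i) IH) => u; rewrite big_cons.
Qed.

(** exp(t cos(wu)) is a power series in cos(wu) with nonnegative
    coefficients. *)
Lemma levy_exponent_cos w : levy_exponent (fun u => 1 - cos (w * u)).
Proof.
move=> t t0.
have ce : contractive (fun u => expR (t * cos (w * u))).
  apply: (@contractive_power_series (fun k => t ^+ k / k`!%:R)
    (fun u => cos (w * u))).
  - by move=> k; rewrite divr_ge0// exprn_ge0.
  - exact: contractive_comp_mul contractive_cos.
  - move=> u; rewrite /expR.
    rewrite (_ : (fun k => t ^+ k / k`!%:R * cos (w * u) ^+ k) =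
                 exp_coeff (t * cos (w * u))); first exact: is_cvg_series_exp_coeff.
    by apply/funext => k; rewrite /exp_coeff /= exprMn mulrAC.
apply: contractive_ext (contractiveZ (expR_ge0 (- t)) ce) => u.
by rewrite -expRD; congr expR; ring.
Qed.

End SchurMultipliers.

(** * Discrete Levy-Khinchine formula for ln cosh *)

Section CschSeries.
Variable R : realType.
Implicit Types (x y u v t d h c : R).

Lemma sum_odd_expR m K : 0 < m ->
  \sum_(k < K) 2 * expR (- ((2 * k%:R + 1) * m)) =
  (1 - expR (- (2 * K%:R * m))) / sinh m :> R.
Proof.
move=> m0; have s0 : sinh m != 0 by rewrite gt_eqF// sinh_gt0.
elim: K => [|K IH].
  by rewrite big_ord0 mulr0 mul0r oppr0 expR0 subrr mul0r.
rewrite big_ord_recr /= IH; apply: (mulIf s0).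
rewrite mulrDl !divfK// -(@natr1 _ K).
have -> : - (2 * (K%:R + 1) * m) = - ((2 * K%:R + 1) * m) + - m by ring.
have -> : - (2 * K%:R * m) = - ((2 * K%:R + 1) * m) + m by ring.
by rewrite !expRD sinhE; field.
Qed.

(** Riemann sums of the Levy-Khinchine integral of ln cosh, on a grid of M
    points; the mesh has been absorbed in h and c. *)
Definition csch_series h M c : R :=
  \sum_(n < M) (1 - cos (n.+1%:R * c)) / (n.+1%:R * sinh (n.+1%:R * h)).

(** Exchange of the two summations; the geometric series
    2 sum_k exp(-(2k+1)m) is 1/sinh m. *)
Lemma sum_poisson_series h M K c : 0 < h ->
  \sum_(k < K) poisson_series M (expR (- ((2 * k%:R + 1) * h))) c =
  \sum_(n < M) (1 - cos (n.+1%:R * c)) / (n.+1%:R * sinh (n.+1%:R * h)) *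
     (1 - expR (- (2 * K%:R * (n.+1%:R * h)))).
Proof.
move=> h0; rewrite exchange_big /=; apply: eq_bigr => n _.
have n0 : 0 < n.+1%:R * h by rewrite mulr_gt0.
transitivity ((1 - cos (n.+1%:R * c)) / n.+1%:R *
    \sum_(k < K) 2 * expR (- ((2 * k%:R + 1) * (n.+1%:R * h)))).
  rewrite mulr_sumr; apply: eq_bigr => k _.
  rewrite -expRM_natl mulrN mulrCA.
  by move: (expR _) (cos _) => a b; field; rewrite nat1r pnatr_eq0.
rewrite sum_odd_expR// invfM !mulrA.
by rewrite mulrAC.
Qed.

Lemma csch_series_ndecr h c : 0 < h -> nondecreasing_seq (fun M => csch_series h M c).
Proof.
move=> h0; apply/nondecreasing_seqP => M; rewrite /csch_series big_ord_recr /=.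
rewrite lerDl divr_ge0 ?subr_ge0 ?cos_le1// mulr_ge0// sinh_ge0// mulr_ge0//.
exact: ltW.
Qed.

Lemma sum_poisson_series_le h M K c : 0 < h ->
  \sum_(k < K) poisson_series M (expR (- ((2 * k%:R + 1) * h))) c <= csch_series h M c.
Proof.
move=> h0; rewrite sum_poisson_series//; apply: ler_sum => n _.
rewrite ler_piMr ?gerDl ?oppr_le0 ?expR_ge0//.
rewrite divr_ge0 ?subr_ge0 ?cos_le1// mulr_ge0// sinh_ge0// mulr_ge0//.
exact: ltW.
Qed.

Lemma sum_poisson_series_cvg h M c : 0 < h ->
  \sum_(k < K) poisson_series M (expR (- ((2 * k%:R + 1) * h))) c @[K --> \oo] -->
  csch_series h M c.
Proof.
move=> h0; under eq_fun do rewrite sum_poisson_series//.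
apply: cvg_big => [|n _]; first exact: add_continuous.
set a := _ / _; suff : a * (1 - expR (- (2 * K%:R * (n.+1%:R * h)))) @[K --> \oo]
    --> a * (1 - 0) by rewrite subr0 mulr1.
apply: cvgMl_tmp; apply: cvgB; first exact: cvg_cst.
rewrite (_ : (fun K => _) = fun K : nat => expR (- (2 * (n.+1%:R * h))) ^+ K); last first.
  by apply/funext => K; rewrite -expRM_natl; congr expR; ring.
apply: cvg_expr; rewrite ger0_norm ?expR_ge0// expR_lt1 oppr_lt0.
by rewrite !mulr_gt0.
Qed.

Let h d : R := d * (pi / 2).

Let h_gt0 d : 0 < d -> 0 < h d.
Proof. by move=> d0; rewrite mulr_gt0// divr_gt0 ?pi_gt0. Qed.

Lemma poisson_log_zero d k c : 0 < d ->
  poisson_log (expR (- ((2 * k%:R + 1) * h d))) c =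
  ln (1 + (sin (c / 2) / sinh (d * cos_zero R k / 2)) ^+ 2).
Proof.
move=> d0; rewrite (_ : _ * h d = d * cos_zero R k); last by rewrite /h /cos_zero; ring.
by rewrite poisson_log_expR// mulr_gt0// cos_zero_gt0.
Qed.

Lemma poisson_log_zero_le d k u : 0 < d ->
  poisson_log (expR (- ((2 * k%:R + 1) * h d))) (d * u) <=
  ln (1 + (u / cos_zero R k) ^+ 2).
Proof.
move=> d0; rewrite poisson_log_zero//.
rewrite ler_ln ?posrE ?ltr_pwDl ?sqr_ge0// lerD2l.
have z0 := cos_zero_gt0 R k.
have -> : u / cos_zero R k = (d * u / 2) / (d * cos_zero R k / 2).
  by field; rewrite !gt_eqF.
have w0 : 0 < d * cos_zero R k / 2 by rewrite divr_gt0// mulr_gt0.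
move: (d * u / 2) (d * cos_zero R k / 2) w0 => v w w0.
rewrite (expr_div_n (sin v)) (expr_div_n v).
apply: ler_pM; rewrite ?sqr_ge0 ?invr_ge0 ?sqr_ge0 ?sin2_le//.
by rewrite lef_pV2 ?posrE ?exprn_gt0 ?sinh_gt0// sinh2_ge.
Qed.

(** Each Poisson logarithm is below the corresponding term of Euler's
    product. *)
Lemma csch_series_le d M u : 0 < d -> csch_series (h d) M (d * u) <= lncosh u.
Proof.
move=> d0; have cp := @sum_poisson_series_cvg (h d) M (d * u) (h_gt0 d0).
apply: (cvgr_to_le cp).
near=> K; apply: le_trans (lncosh_prod_le K u); apply: ler_sum => k _.
apply: le_trans (@poisson_log_zero_le d k u d0); apply: poisson_series_le.
by rewrite expR_ge0/= expR_lt1 oppr_lt0 mulr_gt0 ?h_gt0.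
Unshelve. all: by end_near. Qed.

Definition csch_lim d u : R := limn (fun M => csch_series (d * (pi / 2)) M (d * u)).

Lemma csch_series_is_cvg d u : 0 < d ->
  csch_series (h d) M (d * u) @[M --> \oo] --> csch_lim d u.
Proof.
move=> d0; apply: nondecreasing_is_cvgn; first exact: csch_series_ndecr (h_gt0 d0).
by exists (lncosh u) => _ [M _ <-]; exact: csch_series_le.
Qed.

Lemma csch_lim_le d u : 0 < d -> csch_lim d u <= lncosh u.
Proof.
move=> d0; apply: (cvgr_to_le (@csch_series_is_cvg d u d0)).
by near=> M; exact: csch_series_le.
Unshelve. all: by end_near. Qed.

Lemma csch_lim_ge d u K : 0 < d ->
  \sum_(k < K) ln (1 + (sin (d * u / 2) / sinh (d * cos_zero R k / 2)) ^+ 2) <=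
  csch_lim d u.
Proof.
move=> d0.
have cp : \sum_(k < K) poisson_series M (expR (- ((2 * k%:R + 1) * h d))) (d * u)
    @[M --> \oo] -->
    \sum_(k < K) ln (1 + (sin (d * u / 2) / sinh (d * cos_zero R k / 2)) ^+ 2).
  apply: cvg_big => [|k _]; first exact: add_continuous.
  rewrite -poisson_log_zero//; apply: poisson_series_cvg.
  by rewrite expR_ge0/= expR_lt1 oppr_lt0 mulr_gt0 ?h_gt0.
apply: (ler_cvg_to cp (@csch_series_is_cvg d u d0)); near=> M.
exact: sum_poisson_series_le (h_gt0 d0).
Unshelve. all: by end_near. Qed.

Lemma sin_div_sinh_cvg (D : nat -> R) u z : 0 < z -> (forall m, 0 < D m) ->
  D m @[m --> \oo] --> (0 : R) ->
  (sin (D m * u / 2) / sinh (D m * z / 2)) ^+ 2 @[m --> \oo] --> (u / z) ^+ 2.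
Proof.
move=> z0 D0 D_0.
have c0 w : D m * w / 2 @[m --> \oo] --> (0 : R).
  suff : D m * w / 2 @[m --> \oo] --> 0 * w / 2 by rewrite !mul0r.
  by apply: cvgMr_tmp; apply: cvgMr_tmp.
have lo : (u / z) ^+ 2 * (cos (D m * u / 2) / cosh (D m * z / 2)) ^+ 2 @[m --> \oo]
    --> (u / z) ^+ 2 * (cos 0 / cosh 0) ^+ 2.
  apply: cvgMl_tmp.
  have cq : cos (D m * u / 2) / cosh (D m * z / 2) @[m --> \oo] --> cos 0 / cosh (0 : R).
    apply: cvgM.
      by apply: continuous_cvg; [exact: continuous_cos|exact: c0].
    apply: cvgV; first by rewrite cosh0 oner_neq0.
    by apply: continuous_cvg; [exact: continuous_cosh|exact: c0].
  by rewrite expr2; under eq_fun do rewrite expr2; apply: cvgM.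
rewrite cos0 cosh0 divr1 expr1n mulr1 in lo.
apply: (squeeze_cvgr _ lo (cvg_cst _)); near=> m.
have vpi : `|D m * u / 2| <= pi / 2.
  near: m; have /cvgr0_norm_le := c0 u; apply.
  by rewrite divr_gt0 ?pi_gt0.
have w0 : 0 < D m * z / 2 by rewrite divr_gt0 ?mulr_gt0.
have -> : u / z = (D m * u / 2) / (D m * z / 2).
  by field; rewrite !gt_eqF.
move: (D m * u / 2) (D m * z / 2) vpi w0 => v w vpi w0.
have s0 := sinh_gt0 w0; have ch0 := cosh_gt0 w.
rewrite -exprMn mulf_div (expr_div_n (sin v)) (expr_div_n (v * _)) (expr_div_n v).
have wc : 0 < w * cosh w by exact: mulr_gt0.
apply/andP; split; apply: ler_pM; rewrite ?sqr_ge0 ?invr_ge0 ?sqr_ge0 ?sin2_le ?sin2_ge//.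
  by rewrite lef_pV2 ?posrE ?exprn_gt0// sinh2_le.
by rewrite lef_pV2 ?posrE ?exprn_gt0// sinh2_ge.
Unshelve. all: by end_near. Qed.

(** Squeeze between [csch_lim_le] and [csch_lim_ge]: in the latter, K is fixed
    first, according to the error in Euler's product, and then the mesh D m is
    refined. *)
Lemma csch_lim_cvg (D : nat -> R) u : (forall m, 0 < D m) ->
  D m @[m --> \oo] --> (0 : R) -> csch_lim (D m) u @[m --> \oo] --> lncosh u.
Proof.
move=> D0 D_0.
suff near_le (e : R) : 0 < e -> \forall m \near \oo, `|lncosh u - csch_lim (D m) u| <= e.
  by apply/cvgrPdist_le.
move=> e0; set C := 8 * (u * cosh u) ^+ 2.
have C0 : 0 <= C by rewrite mulr_ge0// sqr_ge0.
have [K Ke] : exists K : nat, C / K.+1%:R <= e / 2.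
  exists (Num.bound (C / (e / 2))).
  have e2 : 0 < e / 2 by rewrite divr_gt0.
  rewrite ler_pdivrMr// mulrC -ler_pdivrMr// ltW// (lt_trans (archi_boundP _))//.
    by rewrite divr_ge0// ltW.
  by rewrite ltr_nat.
have Kc : \sum_(k < K) ln (1 + (sin (D m * u / 2) / sinh (D m * cos_zero R k / 2)) ^+ 2)
    @[m --> \oo] --> \sum_(k < K) ln (1 + (u / cos_zero R k) ^+ 2).
  apply: cvg_big => [|k _]; first exact: add_continuous.
  apply: continuous_cvg; first by apply: continuous_ln; rewrite ltr_pwDl// sqr_ge0.
  by apply: cvgD; [exact: cvg_cst|apply: sin_div_sinh_cvg => //; exact: cos_zero_gt0].
near=> m.
have hle := csch_lim_le u (D0 m).
have hge := @csch_lim_ge (D m) u K (D0 m).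
have hK := lncosh_le_prod K u; rewrite -/C in hK.
have hm : \sum_(k < K) ln (1 + (u / cos_zero R k) ^+ 2) -
   \sum_(k < K) ln (1 + (sin (D m * u / 2) / sinh (D m * cos_zero R k / 2)) ^+ 2) <= e / 2.
  apply: (le_trans (ler_norm _)); near: m.
  by move/cvgrPdist_le : Kc; apply; rewrite divr_gt0.
rewrite ger0_norm ?subr_ge0//; move: Ke hK hm hge.
move: (C / _) (\sum_(k < K) _) (\sum_(k < K) _) => a b c; lra.
Unshelve. all: by end_near. Qed.

Lemma csch_series_levy b d M : 0 < b ->
  levy_exponent (fun u => csch_series b M (d * u)).
Proof.
move=> b0.
apply: (@levy_exponent_ext _ (fun u => \sum_(n < M)
  (n.+1%:R * sinh (n.+1%:R * b))^-1 * (1 - cos (n.+1%:R * d * u)))) => [u|].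
  by apply: eq_bigr => n _; rewrite mulrC mulrA.
apply: levy_exponent_sum => n; apply: levy_exponentZ; last exact: levy_exponent_cos.
by rewrite invr_ge0 mulr_ge0// sinh_ge0// mulr_ge0// ltW.
Qed.

(** The coefficient of 1 - cos is nonnegative because sinh(ra) >= r sinh(a). *)
Lemma csch_series_diff_levy b d r M : 0 < b -> 1 <= r ->
  levy_exponent (fun u => csch_series (b / r) M (d * u) - r * csch_series b M (d * u)).
Proof.
move=> b0 r1; have r0 : 0 < r by rewrite (lt_le_trans _ r1).
apply: (@levy_exponent_ext _ (fun u => \sum_(n < M)
  ((n.+1%:R * sinh (n.+1%:R * (b / r)))^-1 - r * (n.+1%:R * sinh (n.+1%:R * b))^-1) *
   (1 - cos (n.+1%:R * d * u)))) => [u|].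
  rewrite /csch_series mulr_sumr -sumrB; apply: eq_bigr => n _.
  by rewrite mulrBl !(mulrC (1 - _)) !mulrA.
apply: levy_exponent_sum => n; apply: levy_exponentZ; last exact: levy_exponent_cos.
have n0 : 0 < n.+1%:R :> R by [].
rewrite !invfM [r * _]mulrCA -mulrBr mulr_ge0 ?invr_ge0// subr_ge0.
have s1 : 0 < sinh (n.+1%:R * b) by rewrite sinh_gt0// mulr_gt0.
have s2 : 0 < sinh (n.+1%:R * (b / r)) by rewrite sinh_gt0// mulr_gt0// divr_gt0.
rewrite ler_pdivrMr// mulrC ler_pdivlMr//.
rewrite [X in _ <= sinh X](_ : _ = r * (n.+1%:R * (b / r))); last by field; rewrite gt_eqF.
by rewrite sinh_mul_ge// mulr_ge0// divr_ge0// ltW.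
Qed.

Lemma lncosh_levy : levy_exponent (@lncosh R).
Proof.
have D0 m : 0 < @harmonic R m by rewrite invr_gt0.
apply: (@levy_exponent_cvg _ (fun m => csch_lim (harmonic m))) => [m|u]; last first.
  by apply: csch_lim_cvg => //; exact: cvg_harmonic.
apply: (@levy_exponent_cvg _ (fun M u => csch_series (h (harmonic m)) M (harmonic m * u)))
  => [M|u]; last exact: csch_series_is_cvg.
exact: csch_series_levy (h_gt0 (D0 m)).
Qed.

(** The two sums are taken with meshes d/r and d, so that both involve the
    same functions 1 - cos(ndu). *)
Lemma lncosh_diff_levy r : 1 <= r ->
  levy_exponent (fun u => lncosh (r * u) - r * lncosh u).
Proof.
move=> r1; have r0 : 0 < r by rewrite (lt_le_trans _ r1).
have D0 m : 0 < @harmonic R m by rewrite invr_gt0.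
have Dr0 m : 0 < @harmonic R m / r by rewrite divr_gt0.
have Dr : @harmonic R m / r @[m --> \oo] --> (0 : R).
  suff : @harmonic R m / r @[m --> \oo] --> 0 / r by rewrite mul0r.
  by apply: cvgMr_tmp; exact: cvg_harmonic.
apply: (@levy_exponent_cvg _ (fun m u => csch_lim (harmonic m / r) (r * u) -
    r * csch_lim (harmonic m) u)) => [m|u]; last first.
  apply: cvgB; first exact: (@csch_lim_cvg (fun m => harmonic m / r)).
  by apply: cvgMl_tmp; apply: csch_lim_cvg => //; exact: cvg_harmonic.
move: (harmonic m) (D0 m) (Dr0 m) => d d0 dr0.
apply: (@levy_exponent_cvg _ (fun M u => csch_series (h d / r) M (d * u) -
    r * csch_series (h d) M (d * u))) => [M|u].
  exact: csch_series_diff_levy (h_gt0 d0) r1.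
apply: cvgB; last by apply: cvgMl_tmp; exact: csch_series_is_cvg.
have := @csch_series_is_cvg (d / r) (r * u) dr0; rewrite /h.
have -> : d / r * (r * u) = d * u by field; rewrite gt_eqF.
by rewrite mulrAC.
Qed.

End CschSeries.

(** * Ratios of means *)

Section MeanRatios.
Variable R : realType.
Implicit Types (p s t a b x y : R).

Lemma levy_exponent_comp_mul c (f : R -> R) : levy_exponent f ->
  levy_exponent (fun u => f (c * u)).
Proof. by move=> lf t t0; exact: contractive_comp_mul (lf t t0). Qed.

Lemma levy_contractive (f : R -> R) : levy_exponent f ->
  contractive (fun u => expR (- f u)).
Proof. by move/(_ 1 ler01); apply: contractive_ext => u; rewrite mul1r. Qed.

(** Geometric series in g. *)
Lemma contractive_inv1B k (g : R -> R) : 0 <= k < 1 -> contractive g ->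
  (forall u, 0 <= g u <= 1) -> contractive (fun u => (1 - k * g u)^-1).
Proof.
move=> /andP[k0 k1] cg g01.
apply: (@contractive_power_series _ (fun n => k ^+ n) g) => // [n|u].
  exact: exprn_ge0.
have /andP[g0 g1] := g01 u.
have := @cvg_geometric_series R 1 (k * g u).
rewrite mul1r ger0_norm ?mulr_ge0// (le_lt_trans _ k1) ?ler_piMr// => /(_ isT).
rewrite (_ : geometric 1 _ = fun n => k ^+ n * g u ^+ n)//.
by apply/funext => n; rewrite /= mul1r exprMn.
Qed.

(** Homogeneity reduces a mean M(a, b) to the function
    M(a, b) / sqrt(ab) of t = ln a - ln b. *)
Definition heron_ratio s t : R := s + (1 - s) * cosh (t / 2).

Definition binomial_ratio p t : R :=
  if p == 0 then 1 else expR (p^-1 * lncosh (p * t / 2)).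

Lemma sqrt_expR x y : Num.sqrt (expR x * expR y) = expR ((x + y) / 2).
Proof.
rewrite -expRD -{1}[x + y](divfK (x := 2))// mulrC expRM_natl sqrtr_sqr.
by rewrite ger0_norm// expR_ge0.
Qed.

Lemma mean_expR_cosh x y :
  (expR x + expR y) / 2 = expR ((x + y) / 2) * cosh ((x - y) / 2).
Proof.
by rewrite coshE mulrA mulrDr -!expRD; congr ((expR _ + expR _) / _); field.
Qed.

Lemma heron_meanE s a b : 0 < a -> 0 < b ->
  heron_mean s a b = Num.sqrt (a * b) * heron_ratio s (ln a - ln b).
Proof.
move=> a0 b0; rewrite -(lnK a0) -(lnK b0); move: (ln a) (ln b) => x y.
by rewrite /heron_mean !expRK mean_expR_cosh sqrt_expR /heron_ratio; ring.
Qed.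

Lemma binomial_meanE p a b : 0 < a -> 0 < b ->
  binomial_mean p a b = Num.sqrt (a * b) * binomial_ratio p (ln a - ln b).
Proof.
move=> a0 b0; rewrite -(lnK a0) -(lnK b0); move: (ln a) (ln b) => x y.
rewrite /binomial_mean /binomial_ratio !expRK.
have [|p0] := eqVneq p 0; first by rewrite mulr1.
rewrite -!expRM ![_ * p]mulrC mean_expR_cosh -mulrBr.
have e0 : 0 < expR ((p * x + p * y) / 2) * cosh (p * (x - y) / 2).
  by rewrite mulr_gt0 ?expR_gt0 ?cosh_gt0.
rewrite /powR gt_eqF// lnM ?posrE ?expR_gt0 ?cosh_gt0// expRK.
by rewrite mulrDr expRD sqrt_expR; congr (expR _ * _); field.
Qed.

Definition sech2 t : R := expR (- (2 * lncosh (4^-1 * t))).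

Lemma sech2E t : sech2 t = (cosh (t / 4) ^+ 2)^-1.
Proof.
by rewrite /sech2 expRN expRM_natl lnK ?posrE ?cosh_gt0// mulrC.
Qed.

Lemma sech2_bound t : 0 <= sech2 t <= 1.
Proof.
by rewrite expR_ge0/= expR_le1 oppr_le0 mulr_ge0// ln_ge0// cosh_ge1.
Qed.

Lemma sech2_contractive : contractive sech2.
Proof.
exact: levy_contractive (levy_exponentZ (ler0n R 2)
  (levy_exponent_comp_mul 4^-1 (@lncosh_levy R))).
Qed.

(** cosh(t/2) = 2 cosh(t/4)^2 - 1. *)
Lemma heron_ratioE s t :
  heron_ratio s t = (2 * (1 - s) + (2 * s - 1) * sech2 t) / sech2 t.
Proof.
rewrite sech2E /heron_ratio.
have -> : t / 2 = t / 4 + t / 4 by field.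
rewrite coshD; have c0 : cosh (t / 4) != 0 by rewrite gt_eqF// cosh_gt0.
have := cosh2Bsinh2 (t / 4); move: (cosh _) (sinh _) c0 => c d c0.
move=> /eqP; rewrite subr_eq addrC -subr_eq => /eqP e.
by rewrite -!expr2 -e; field.
Qed.

(** For p > 0 the exponent is -2 (ln cosh(ru) - r ln cosh(u)) with r = 1/(2p)
    and u = pt/2; for p <= 0 it is minus a sum of nonnegative multiples of
    ln cosh. *)
Lemma binomial_ratio_sech2 p : p <= 1 / 2 ->
  contractive (fun t => binomial_ratio p t * sech2 t).
Proof.
move=> p2; rewrite /binomial_ratio; have [p0|pneq0] := eqVneq p 0.
  by apply: contractive_ext sech2_contractive => t; rewrite mul1r.
have l4 := levy_exponent_comp_mul 4^-1 (@lncosh_levy R).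
have [p0|p0] := ltP p 0.
  have pV : 0 <= - p^-1 by rewrite oppr_ge0 invr_le0 ltW.
  have lp := levy_exponentZ pV (levy_exponent_comp_mul (p / 2) (@lncosh_levy R)).
  apply: contractive_ext (levy_contractive
    (levy_exponentD lp (levy_exponentZ (ler0n R 2) l4))) => t.
  by rewrite /sech2 -expRD; congr expR; rewrite mulrAC; ring.
have {}p0 : 0 < p by rewrite lt_neqAle eq_sym pneq0.
have r1 : 1 <= (2 * p)^-1 by rewrite invf_ge1 ?mulr_gt0//; lra.
have lr := levy_exponent_comp_mul (p / 2) (lncosh_diff_levy r1).
apply: contractive_ext (levy_contractive (levy_exponentZ (ler0n R 2) lr)) => t.
rewrite /sech2 -expRD; congr expR.
have -> : (2 * p)^-1 * (p / 2 * t) = 4^-1 * t by field.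
have -> : p / 2 * t = p * t / 2 by ring.
by field.
Qed.

(** The exponent is -(1/p) (ln cosh(ru) - r ln cosh(u)) with r = 2p and
    u = t/4. *)
Lemma binomial_ratio_sech2V p : 1 / 2 <= p ->
  contractive (fun t => (binomial_ratio p t * sech2 t)^-1).
Proof.
move=> p2; have p0 : 0 < p by lra.
have r1 : 1 <= 2 * p by lra.
have pV : 0 <= p^-1 by rewrite invr_ge0 ltW.
have lr := levy_exponent_comp_mul 4^-1 (lncosh_diff_levy r1).
apply: contractive_ext (levy_contractive (levy_exponentZ pV lr)) => t.
rewrite /binomial_ratio gt_eqF// /sech2 -expRD -expRN; congr expR.
have -> : 2 * p * (4^-1 * t) = p * t / 2 by field.
by field; rewrite gt_eqF.
Qed.

Lemma sech2_gt0 t : 0 < sech2 t. Proof. exact: expR_gt0. Qed.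

Lemma binomial_ratio_gt0 p t : 0 < binomial_ratio p t.
Proof. by rewrite /binomial_ratio; case: ifP => _; rewrite ?ltr01 ?expR_gt0. Qed.

Lemma lncosh0 : lncosh (0 : R) = 0. Proof. by rewrite /lncosh cosh0 ln1. Qed.

Lemma binomial_ratio0 p : binomial_ratio p 0 = 1.
Proof.
by rewrite /binomial_ratio; case: ifP => // _; rewrite mulr0 mul0r lncosh0 mulr0 expR0.
Qed.

Lemma heron_ratio0 s : heron_ratio s 0 = 1.
Proof. by rewrite /heron_ratio mul0r cosh0; ring. Qed.

Lemma heron_ratio_gt0 s t : 0 <= s <= 1 -> 0 < heron_ratio s t.
Proof.
move=> s01; rewrite /heron_ratio; have := cosh_ge1 (t / 2); move: (cosh _) => c; nra.
Qed.

(** The product of [binomial_ratio_sech2] with a geometric series in sech2. *)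
Lemma binomial_heron_contractive p s : p <= 1 / 2 -> 0 <= s <= 1 / 2 ->
  contractive (fun t => binomial_ratio p t / heron_ratio s t).
Proof.
move=> p2 s2.
have k01 : 0 <= (1 - 2 * s) / (2 - 2 * s) < 1.
  by rewrite divr_ge0 ?ltr_pdivrMr/=; lra.
have cV := contractive_inv1B k01 sech2_contractive sech2_bound.
have A0 : 0 <= (2 - 2 * s)^-1 by rewrite invr_ge0; lra.
apply: contractive_ext (contractiveM (binomial_ratio_sech2 p2) (contractiveZ A0 cV)) => t.
have h0 : 0 < heron_ratio s t by apply: heron_ratio_gt0; lra.
rewrite heron_ratioE in h0 *; have g0 := sech2_gt0 t.
move: h0; rewrite pmulr_lgt0 ?invr_gt0//.
move: (binomial_ratio p t) (sech2 t) g0 => b g g0 h0.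
field; rewrite (gt_eqF g0) /=.
by rewrite !gt_eqF//; lra.
Qed.

Lemma heron_binomial_contractive p s : 1 / 2 <= p -> 1 / 2 <= s <= 1 ->
  contractive (fun t => heron_ratio s t / binomial_ratio p t).
Proof.
move=> p2 s2.
have h1 : 0 <= 2 * s - 1 by lra.
have h2 : 0 <= 2 * (1 - s) by lra.
have ch := contractiveD (contractive_cst h2) (contractiveZ h1 sech2_contractive).
apply: contractive_ext (contractiveM ch (binomial_ratio_sech2V p2)) => t.
by rewrite heron_ratioE -mulrA -invfM [sech2 t * _]mulrC.
Qed.

End MeanRatios.

(** * Comparison of mean operators *)

Section MeanOperators.
Variable R : realType.
Implicit Types (M : R -> R -> R) (p s a b : R).

Lemma shift_cvg_quadrant a b : 0 <= a -> 0 <= b ->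
  (a + harmonic k, b + harmonic k) @[k --> \oo] -->
  within (@pos_quadrant R) (nbhs (a, b)).
Proof.
move=> a0 b0.
have c (x : R) : x + harmonic k @[k --> \oo] --> x.
  suff : x + harmonic k @[k --> \oo] --> x + 0 by rewrite addr0.
  by apply: cvgD; [exact: cvg_cst|exact: cvg_harmonic].
have cab : (a + harmonic k, b + harmonic k) @[k --> \oo] --> (a, b).
  exact: (cvg_pair (c a) (c b)).
move=> A hA; rewrite nbhs_simpl /=; near=> k.
have : pos_quadrant (a + harmonic k, b + harmonic k) -> A (a + harmonic k, b + harmonic k).
  by near: k; exact: (cab _ hA).
by apply; split; rewrite /= ltr_wpDl// invr_gt0.
Unshelve. all: by end_near. Qed.

(** The limit that defines [mean_ext] exists. *)
Definition extends_continuously M := forall a b, 0 <= a -> 0 <= b ->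
  M z.1 z.2 @[z --> within (@pos_quadrant R) (nbhs (a, b))] --> mean_ext M a b.

Lemma heron_extends s : extends_continuously (heron_mean s).
Proof.
by move=> a b a0 b0; rewrite heron_mean_ext//; exact: heron_mean_cvg.
Qed.

Lemma binomial_extends p : extends_continuously (binomial_mean p).
Proof.
by move=> a b a0 b0; rewrite binomial_mean_ext//; exact: binomial_mean_cvg.
Qed.

Lemma mean_ext_shift_cvg M a b : extends_continuously M -> 0 <= a -> 0 <= b ->
  M (a + harmonic k) (b + harmonic k) @[k --> \oo] --> mean_ext M a b.
Proof.
move=> cM a0 b0.
exact: (cvg_comp (fun k => (a + harmonic k, b + harmonic k))
  (fun z : R * R => M z.1 z.2) (shift_cvg_quadrant a0 b0) (cM a b a0 b0)).
Qed.

Lemma norm_mean_op n (N : 'M[R[i]]_n -> R) M S T X : unitarily_invariant_norm N ->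
  N (mean_op M S T X) = N (schur (fun i j =>
    mean_ext M (complex.Re (spectral_diag S 0 i)) (complex.Re (spectral_diag T 0 j)))
    (spectralmx S *m X *m (spectralmx T)^t*)).
Proof.
move=> HN; rewrite /mean_op /mean_op_eig !trmxCK (uin_unitary HN).
- rewrite /schur.
  have -> : \matrix_(i, j) (mean_ext M (map_mx (@complex.Re R) (spectral_diag S) 0 i)
      (map_mx (@complex.Re R) (spectral_diag T) 0 j))%:C =
    \matrix_(i, j) (mean_ext M (complex.Re (spectral_diag S 0 i))
      (complex.Re (spectral_diag T 0 j)))%:C.
    by apply/matrixP => i j; rewrite !mxE.
  by [].
- by rewrite trmxC_unitary spectral_unitarymx.
- exact: spectral_unitarymx.
Qed.

(** Shifting all eigenvalues by a small positive amount makes them positive,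
    where the factorization of the matrices applies; then pass to the limit. *)
Lemma mean_op_le (M1 M2 : R -> R -> R) f :
    extends_continuously M1 -> extends_continuously M2 ->
    contractive f -> f 0 = 1 ->
    (forall a b, 0 < a -> 0 < b -> M1 a b = f (ln a - ln b) * M2 a b) ->
  forall n (N : 'M[R[i]]_n -> R) S T X, unitarily_invariant_norm N ->
    possemidefmx S -> possemidefmx T -> N (mean_op M1 S T X) <= N (mean_op M2 S T X).
Proof.
move=> c1 c2 [_ cf] f0 M12 n N S T X HN Sp Tp; rewrite !norm_mean_op//.
set Y := _ *m _ *m _.
pose lam i := complex.Re (spectral_diag S 0 i).
pose mu j := complex.Re (spectral_diag T 0 j).
have l0 i : 0 <= lam i by exact: possemidefmx_spectral_ge0.
have m0 j : 0 <= mu j by exact: possemidefmx_spectral_ge0.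
have lim1 := schur_norm_cvg HN (X := Y) (fun i j => mean_ext_shift_cvg c1 (l0 i) (m0 j)).
have lim2 := schur_norm_cvg HN (X := Y) (fun i j => mean_ext_shift_cvg c2 (l0 i) (m0 j)).
apply: (ler_cvg_to lim1 lim2); near=> k.
have k0 : 0 < harmonic k :> R by rewrite invr_gt0.
have -> : schur (fun i j => M1 (lam i + harmonic k) (mu j + harmonic k)) Y =
    schur (fun i j => f (ln (lam i + harmonic k) - ln (mu j + harmonic k)))
      (schur (fun i j => M2 (lam i + harmonic k) (mu j + harmonic k)) Y).
  rewrite schurM; apply/matrixP => i j; rewrite !mxE.
  by rewrite M12// ltr_wpDl.
by rewrite (le_trans (cf _ _ _ _ _ HN))// f0 mul1r.
Unshelve. all: by end_near. Qed.

End MeanOperators.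

Theorem proposition3p10 (R : realType) (p s : R) (s01 : 0 <= s <= 1) :
  (p <= 1 / 2 -> 0 <= s <= 1 / 2 ->
    forall (n : nat) (N : 'M[R[i]]_n -> R) (S T X : 'M[R[i]]_n),
      unitarily_invariant_norm N -> possemidefmx S -> possemidefmx T ->
      N (mean_op (binomial_mean p) S T X) <= N (mean_op (heron_mean s) S T X))
  /\
  (1 / 2 <= p -> 1 / 2 <= s <= 1 ->
    forall (n : nat) (N : 'M[R[i]]_n -> R) (S T X : 'M[R[i]]_n),
      unitarily_invariant_norm N -> possemidefmx S -> possemidefmx T ->
      N (mean_op (heron_mean s) S T X) <= N (mean_op (binomial_mean p) S T X)).
Proof.
split=> p2 s2 n N S T X HN HS HT.
  have r0 : binomial_ratio p 0 / heron_ratio s 0 = 1.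
    by rewrite binomial_ratio0 heron_ratio0 divr1.
  have rE a b : 0 < a -> 0 < b -> binomial_mean p a b =
      binomial_ratio p (ln a - ln b) / heron_ratio s (ln a - ln b) * heron_mean s a b.
    move=> a0 b0; rewrite binomial_meanE// heron_meanE// mulrCA divfK//.
    by rewrite gt_eqF// heron_ratio_gt0.
  exact: (mean_op_le (@binomial_extends R p) (@heron_extends R s)
    (binomial_heron_contractive p2 s2) r0 rE X HN HS HT).
have r0 : heron_ratio s 0 / binomial_ratio p 0 = 1.
  by rewrite binomial_ratio0 heron_ratio0 divr1.
have rE a b : 0 < a -> 0 < b -> heron_mean s a b =
    heron_ratio s (ln a - ln b) / binomial_ratio p (ln a - ln b) * binomial_mean p a b.
  move=> a0 b0; rewrite binomial_meanE// heron_meanE// mulrCA divfK//.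
  by rewrite gt_eqF// binomial_ratio_gt0.
exact: (mean_op_le (@heron_extends R s) (@binomial_extends R p)
  (heron_binomial_contractive p2 s2) r0 rE X HN HS HT).
Qed.
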